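(* For every real $\delta>0$ there exist constants $\kappa>0$ and $n_0$, depending only on $\delta$, such that the following holds. Let $\mathbb{F}=\mathbb{F}_q$ be any prime field, let $n\ge n_0$, and let $f:\mathbb{F}^n\to\mathbb{F}$ be a polynomial of degree five with $\mathrm{bias}(f)=\delta$. Then there exists an affine subspace $V\subseteq\mathbb{F}^n$ of dimension at least $\kappa n$ such that the restriction $f|_V$ is constant.
   Context: For a finite prime field $\mathbb{F}$ and a function $f:\mathbb{F}^n\to\mathbb{F}$, $\mathrm{bias}(f):=\left|\mathbb{E}_{x\in\mathbb{F}^n}\left[\omega^{f(x)}\right]\right|$, where $\omega=e^{2\pi i/|\mathbb{F}|}$ and $x$ is uniform in $\mathbb{F}^n$. Polynomials are regarded as functions $\mathbb{F}^n\to\mathbb{F}$; the degree of such a function is the total degree of its unique representation as a polynomial with each individual degree at most $|\mathbb{F}|-1$. *)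

(* Defs.v *)
From mathcomp Require Import all_boot all_order all_algebra.
From mathcomp Require Import complex mpoly reals trigo.
Set Implicit Arguments.
Unset Strict Implicit.
Unset Printing Implicit Defensive.
Import Order.TTheory GRing.Theory Num.Theory.
Local Open Scope ring_scope.
Local Open Scope complex_scope.

(* e^{2 i pi / p} *)
Definition omega (R : realType) (p : nat) : R[i] :=
  cos (2%:R * pi / p%:R) +i* sin (2%:R * pi / p%:R).

(* The exponent [f x : 'F_p] is read as its representative in {0, .., p - 1}
   when p is prime; [normc] is the complex modulus, with values in R. *)
Definition bias (R : realType) (p n : nat) (f : 'rV['F_p]_n -> 'F_p) : R :=
  ComplexField.Normc.normc
    ((\sum_(x : 'rV['F_p]_n) omega R p ^+ f x) / #|{: 'rV['F_p]_n}|%:R).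

Definition represents (F : finFieldType) (n : nat)
    (P : {mpoly F[n]}) (f : 'rV[F]_n -> F) : Prop :=
  forall x : 'rV[F]_n, f x = P.@[fun i : 'I_n => x 0 i].

Definition reduced (F : finFieldType) (n : nat) (P : {mpoly F[n]}) : Prop :=
  forall m : 'X_{1..n}, m \in msupp P -> forall i : 'I_n, (m i <= #|F|.-1)%N.

(* Every f has exactly one reduced representation P, and [msize P] is 1 plus
   the total degree of P (0 for P = 0). *)
Definition function_degree (F : finFieldType) (n : nat)
    (f : 'rV[F]_n -> F) (d : nat) : Prop :=
  exists P : {mpoly F[n]}, [/\ reduced P, represents P f & msize P = d.+1].

Definition affine_subspace (F : finFieldType) (n : nat)
    (a : 'rV[F]_n) (W : {vspace 'rV[F]_n}) : {set 'rV[F]_n} :=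
  [set x | x - a \in W].

Definition constant_on (T : finType) (U : Type) (f : T -> U) (V : {set T}) :
    Prop :=
  exists c : U, forall x : T, x \in V -> f x = c.

(* Main.v *)
Require Import Defs.
From mathcomp Require Import all_boot all_order all_algebra.
From mathcomp Require Import reals.
From mathcomp Require Import zify ring.
From mathcomp Require Import finfield boolp.
From mathcomp Require Import complex mpoly trigo.
Set Implicit Arguments.
Unset Strict Implicit.
Unset Printing Implicit Defensive.
Import Order.TTheory GRing.Theory Num.Theory.
Local Open Scope ring_scope.

(** The degree of a biased polynomial can be lowered one unit at a time, at the
    cost of passing to an affine subspace whose dimension is a fixed fraction of
    the current one, until a constant is left.

    Let [f] have degree at most [d <= 5] and bias at least [q ^- r], and let [T]
    be its [d]-th derivative, a [d]-linear form. Cauchy-Schwarz ([d] times) shows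
    that [T] is biased ([biased_top_form]). A biased multilinear form has bounded
    partition rank ([uniform_rank_bound_exists]): it is a sum of boundedly many
    products [A * B], where [A] and [B] are forms on complementary nonempty sets
    of slots. As [d <= 5], one factor of each product involves at most two slots,
    so it is a linear or a bilinear form. Boundedly many linear and bilinear forms
    vanish together on a subspace [W] of dimension proportional to [n]: such a
    subspace is built greedily, each new vector being a common zero of few
    quadratic forms, which Chevalley-Warning provides ([isotropic_exists]). On
    every coset of [W] the polynomial has degree at most [d - 1], since its [d]-th
    derivative there is the restriction of [T]; and by averaging the bias of [f]
    survives on one of these cosets ([reduce_degree]). In degree six a product of
    two trilinear forms can occur, and the argument breaks down.

    The bound on the partition rank is proved by induction on the number of slots.
    Single out a slot [i] of a biased form [T] and let [Z] be the set of points at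
    which all slices [T (.., u, ..)] vanish, [u] standing in slot [i]; the bias of
    [T] is the density of [Z]. A bounded number of random slices already cut out a
    set [Y] containing [Z] in which [Z] is almost everything ([sampling]). Refine
    these slices into a bounded family [A] of forms of positive but lower order that
    generates them, and which is so regular that no combination of its members on
    the same slots has small partition rank ([regularize]). Since [Y] is a union of
    atoms (joint level sets) of [A], in some atom almost every point lies in [Z].
    Now take any slice. Up to a combination of the sampled slices it is biased, hence
    by induction it is generated by [A] and boundedly many further forms, which can
    be regularized relatively to [A] into a family [B]; thus it is a squarefree
    polynomial in the values of [A] and [B]. By regularity and induction these
    values are jointly equidistributed ([equidistributed]). A monomial that
    involves no member of [A] would make the slice nonzero on a definite proportion
    of every atom of [A], which the atom above excludes ([atom_ideal]). So every
    slice lies in the ideal generated by [A], and hence so does [T], which therefore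
    is a sum of at most [#|A|] products. The bounds depend neither on [n] nor on
    the field. *)

(** * Changing one coordinate *)

Section Update.
Variables (I U : finType).
Implicit Types (x : {ffun I -> U}) (i j : I) (u : U).

Definition upd x i u : {ffun I -> U} := [ffun j => if j == i then u else x j].

Lemma updE x i u j : upd x i u j = if j == i then u else x j.
Proof. by rewrite ffunE. Qed.

Lemma upd_id x i : upd x i (x i) = x.
Proof. by apply/ffunP => j; rewrite updE; case: eqP => [->|]. Qed.

Lemma upd_upd x i u v : upd (upd x i u) i v = upd x i v.
Proof. by apply/ffunP => j; rewrite !updE; case: eqP. Qed.

Lemma updC x i j u v : i != j -> upd (upd x i u) j v = upd (upd x j v) i u.
Proof.
move=> neij; apply/ffunP => l; rewrite !updE; case: (eqVneq l j) => // ->.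
by rewrite eq_sym (negPf neij).
Qed.

(** Resampling one coordinate leaves the uniform distribution unchanged: the map
    [(x, u) |-> (upd x i u, x i)] is an involution. *)
Lemma sum_upd (C : nmodType) (G : {ffun I -> U} -> C) i :
  \sum_x \sum_u G (upd x i u) = (\sum_x G x) *+ #|U|.
Proof.
rewrite -sumrMnl pair_big /=.
rewrite (reindex_inj (h := fun z => (upd z.1 i z.2, z.1 i))) /=.
  transitivity (\sum_x \sum_(u : U) G x).
    by rewrite pair_big /=; apply: eq_bigr => -[x u] _ /=; rewrite upd_upd upd_id.
  by apply: eq_bigr => x _; rewrite sumr_const.
apply: (can_inj (g := fun z => (upd z.1 i z.2, z.1 i))) => -[x u] /=.
by rewrite upd_upd upd_id updE eqxx.
Qed.

End Update.

(** * Additive characters *)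

Section Characters.
Variables (F : finFieldType) (C : numClosedFieldType).
Implicit Type psi : F -> C.

Definition addchar psi :=
  [/\ {morph psi : a b / a + b >-> a * b}, forall a, `|psi a| = 1
    & exists a, psi a != 1].

Lemma sum_twist0 (U : finType) (chi : U -> C) (t : U -> U) (c : C) :
  injective t -> c != 1 -> (forall u, chi (t u) = c * chi u) ->
  \sum_u chi u = 0.
Proof.
move=> t_inj c1 chit.
have : \sum_u chi u = c * \sum_u chi u.
  by rewrite [LHS](reindex_inj t_inj) big_distrr; apply: eq_bigr => u _.
move/eqP; rewrite -{1}[X in X == _]mul1r -subr_eq0 -mulrBl mulf_eq0 subr_eq0.
by rewrite eq_sym (negPf c1) => /eqP.
Qed.

Variable psi : F -> C.
Hypothesis psiP : addchar psi.

Lemma psiD a b : psi (a + b) = psi a * psi b.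
Proof. by case: psiP. Qed.

Lemma psi_norm a : `|psi a| = 1.
Proof. by case: psiP. Qed.

Lemma psi0 : psi 0 = 1.
Proof.
have /eqP := psiD 0 0; rewrite addr0 -{1}[psi 0]mulr1 -subr_eq0 -mulrBr mulf_eq0.
case/orP => /eqP h; first by have := psi_norm 0; rewrite h normr0 => /esym/eqP; rewrite oner_eq0.
by apply/esym/eqP; rewrite -subr_eq0 h.
Qed.

Lemma psiN a : psi (- a) = (psi a)^*.
Proof.
have e : psi a * psi (- a) = 1 by rewrite -psiD subrr psi0.
have n : psi a * (psi a)^* = 1 by rewrite -normCK psi_norm expr1n.
have nz : psi a != 0 by rewrite -normr_eq0 psi_norm oner_eq0.
by apply: (mulfI nz); rewrite e n.
Qed.

Lemma psi_scale (b : F) : b != 0 -> exists a, psi (a * b) != 1.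
Proof.
move=> b0; case: psiP => _ _ [a ha]; exists (a / b).
by rewrite mulfVK.
Qed.

Lemma sum_psi_dot (A : finType) (b : {ffun A -> F}) :
  \sum_(a : {ffun A -> F}) psi (\sum_j a j * b j) =
  if b == [ffun => 0] then (#|F| ^ #|A|)%:R else 0.
Proof.
case: eqP => [->|/eqP b0].
  rewrite (eq_bigr (fun=> 1)) => [|a _]; last first.
    by rewrite big1 ?psi0 // => j _; rewrite ffunE mulr0.
  by rewrite sumr_const card_ffun.
have [j bj] : exists j, b j != 0.
  apply/existsP; apply: contraR b0; rewrite negb_exists => /forallP h.
  by apply/eqP/ffunP => j; rewrite ffunE; apply/eqP; have := h j; rewrite negbK.
have [c hc] := psi_scale bj.
apply: (sum_twist0 (t := fun a => upd a j (c + a j)) (c := psi (c * b j))) => //.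
  apply: (can_inj (g := fun a => upd a j (a j - c))) => a.
  by rewrite upd_upd updE eqxx addrC addKr upd_id.
move=> a; rewrite -psiD; congr psi.
rewrite (bigD1 j) //= [in RHS](bigD1 j) //= updE eqxx mulrDl -addrA.
congr (_ + (_ + _)); apply: eq_bigr => l /negPf nl; by rewrite updE nl.
Qed.

End Characters.

(** * Multilinear forms and their bias *)

Section Multilinear.
Variables (F : finFieldType) (n : nat) (I : finType).
Notation V := 'rV[F]_n.
Notation X := {ffun I -> V}.
Implicit Types (x : X) (i : I) (J K : {set I}) (h g : X -> F).

Definition lin_at i h :=
  forall x a u v, h (upd x i (a *: u + v)) = a * h (upd x i u) + h (upd x i v).

Definition indep i h := forall x u, h (upd x i u) = h x.

(** A form in some of the variables is a function of all of them, so that forms on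
    different sets [J] of slots can be added and multiplied without any casts. *)
Definition multilin J h :=
  (forall i, i \in J -> lin_at i h) /\ (forall i, i \notin J -> indep i h).

Lemma lin_at0 i h x : lin_at i h -> h (upd x i 0) = 0.
Proof. by move=> /(_ x (-1) 0 0); rewrite scaler0 addr0 mulN1r addNr. Qed.

Lemma eq_lin_at i h g : h =1 g -> lin_at i h -> lin_at i g.
Proof. by move=> e hl x a u v; rewrite -!e. Qed.

Lemma lin_at_sum i (S : finType) (P : pred S) (f : S -> X -> F) :
  (forall s, P s -> lin_at i (f s)) -> lin_at i (fun x => \sum_(s | P s) f s x).
Proof.
move=> hl x a u v; rewrite big_distrr -big_split /=.
by apply: eq_bigr => s Ps; rewrite hl.
Qed.

Lemma indep_sum i (S : finType) (P : pred S) (f : S -> X -> F) :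
  (forall s, P s -> indep i (f s)) -> indep i (fun x => \sum_(s | P s) f s x).
Proof. by move=> hl x u; apply: eq_bigr => s Ps; rewrite hl. Qed.

Lemma lin_atDf i h g : lin_at i h -> lin_at i g -> lin_at i (fun x => h x + g x).
Proof. by move=> lh lg x a u v; rewrite lh lg mulrDr addrACA. Qed.

Lemma lin_atMl i h g : lin_at i h -> indep i g -> lin_at i (fun x => h x * g x).
Proof. by move=> lh lg x a u v; rewrite lh !lg mulrDl mulrA. Qed.

Lemma lin_atMr i h g : indep i h -> lin_at i g -> lin_at i (fun x => h x * g x).
Proof. by move=> lh lg x a u v; rewrite lg !lh mulrDr mulrCA. Qed.

Lemma indepM i h g : indep i h -> indep i g -> indep i (fun x => h x * g x).
Proof. by move=> lh lg x u; rewrite lh lg. Qed.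

Lemma eq_multilin J h g : h =1 g -> multilin J h -> multilin J g.
Proof.
by move=> e [hl hi]; split=> i /[dup] ? => [/hl/(eq_lin_at e) //|/hi k x u]; rewrite -!e k.
Qed.

Lemma multilin_sum J (S : finType) (P : pred S) (f : S -> X -> F) :
  (forall s, P s -> multilin J (f s)) -> multilin J (fun x => \sum_(s | P s) f s x).
Proof.
move=> fl; split=> i iJ; first by apply: lin_at_sum => s /fl[+ _]; apply.
by apply: indep_sum => s /fl[_]; apply.
Qed.

Lemma multilin_scale J a h : multilin J h -> multilin J (fun x => a * h x).
Proof.
move=> [hl hi]; split=> i iJ; first by apply: lin_atMr => //; apply: hl.
by apply: indepM => //; apply: hi.
Qed.

Lemma multilinD J h g : multilin J h -> multilin J g -> multilin J (fun x => h x + g x).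
Proof.
move=> [hl hi] [gl gi]; split=> i iJ; first exact: lin_atDf (hl i iJ) (gl i iJ).
by move=> x u; rewrite hi ?gi.
Qed.

Lemma multilin0 J : multilin J (fun=> 0).
Proof. by split=> i _ // x a u v; rewrite mulr0 addr0. Qed.

Lemma multilinM J K h g :
  [disjoint J & K] -> multilin J h -> multilin K g -> multilin (J :|: K) (fun x => h x * g x).
Proof.
move=> dis [hl hi] [gl gi]; split=> i; rewrite inE.
  case/orP => iJK.
    apply: lin_atMl; [exact: hl | apply: gi].
    by have /disjointFr -> := dis.
  apply: lin_atMr; [apply: hi | exact: gl].
  by have /disjointFl -> := dis.
by case/norP=> iJ iK; apply: indepM; [apply: hi | apply: gi].
Qed.

Lemma multilin_prod (S : finType) (P : {set S}) (d : S -> {set I}) (f : S -> X -> F) :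
  (forall s, multilin (d s) (f s)) ->
  {in P &, forall s t, s != t -> [disjoint d s & d t]} ->
  multilin (\bigcup_(s in P) d s) (fun x => \prod_(s in P) f s x).
Proof.
move=> fl dis; split=> i.
  case/bigcupP => s sP ids.
  apply: (@eq_lin_at _ (fun x => f s x * \prod_(t in P | t != s) f t x)).
    by move=> x; rewrite -bigD1.
  apply: lin_atMl; first by apply: (fl s).1.
  move=> x u; apply: eq_bigr => t /andP[tP nts].
  by rewrite (fl t).2 // (disjointFl (dis t s tP sP nts)).
move=> iP x u; apply: eq_bigr => s sP; rewrite (fl s).2 //.
by apply: contra iP => ids; apply/bigcupP; exists s.
Qed.

Lemma multilin_local (J : {set I}) (h : X -> F) (x z : X) :
  multilin J h -> {in J, x =1 z} -> h x = h z.
Proof.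
move=> hJ xz; pose w l := foldr (fun j y => upd y j (x j)) z l.
have wE l i : w l i = if i \in l then x i else z i.
  elim: l => //= j l IH; rewrite updE inE.
  by case: (eqVneq i j) => [-> | _] //=.
have hw l : {subset l <= [pred i | i \notin J]} -> h (w l) = h z.
  elim: l => //= j l IH lJ; rewrite hJ.2; last by apply: lJ; rewrite inE eqxx.
  by apply: IH => i il; apply: lJ; rewrite inE il orbT.
rewrite -(hw (enum [pred i | i \notin J])) => [|i]; last by rewrite mem_enum.
congr h; apply/ffunP => i; rewrite wE mem_enum inE.
by case: (boolP (i \in J)) => // /xz.
Qed.

Variables (C : numClosedFieldType) (psi : F -> C).
Hypothesis psiP : addchar psi.

(** For [h] linear in slot [i], these are the points at which the linear functional
    filling slot [i] is zero; the condition does not depend on [x i]. *)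
Definition zero_at i h x := [forall u, h (upd x i u) == 0].

(** Averaging over slot [i] a character of a linear functional gives 1 or 0 according
    to whether the functional is zero. *)
Lemma sum_psi_lin i h g : lin_at i h -> indep i g ->
  \sum_x psi (h x + g x) = \sum_(x | zero_at i h x) psi (g x).
Proof.
move=> hl gi.
have V0 : (#|{: V}|%:R : C) != 0.
  by rewrite pnatr_eq0 -lt0n; apply/card_gt0P; exists 0.
apply: (mulIf V0); rewrite [LHS]mulr_natr [RHS]mulr_natr -(sum_upd _ i).
rewrite -sumrMnl [RHS]big_mkcond /=; apply: eq_bigr => x _.
case: ifPn => [/forallP hz | ].
  rewrite (eq_bigr (fun=> psi (g x))) ?sumr_const // => u _.
  by rewrite (eqP (hz u)) add0r gi.
rewrite negb_forall => /existsP[u hu].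
have [c hc] := psi_scale psiP hu.
apply: (sum_twist0 (t := fun v => c *: u + v) _ hc); first exact: addrI.
by move=> v; rewrite hl !gi -addrA; apply: psiD psiP _ _.
Qed.

Lemma sum_psi_lin_card i h : lin_at i h ->
  \sum_x psi (h x) = #|[pred x | zero_at i h x]|%:R.
Proof.
move=> hl; have := @sum_psi_lin i h (fun=> 0) hl (fun _ _ => erefl).
under eq_bigr do rewrite addr0.
move=> ->; rewrite (eq_bigr (fun=> 1)) ?sumr_const // => x _.
exact: (psi0 psiP).
Qed.

Lemma norm_sum_psi_lin i h g : lin_at i h -> indep i g ->
  `|\sum_x psi (h x + g x)| <= `|\sum_x psi (h x)|.
Proof.
move=> hl gi; rewrite (sum_psi_lin hl gi) (sum_psi_lin_card hl) normr_nat.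
apply: le_trans (ler_norm_sum _ _ _) _.
by rewrite (eq_bigr (fun=> 1)) ?sumr_const // => x _; apply: psi_norm.
Qed.

(** Terms that miss a slot of [J] cannot increase the bias of a form on [J]: by
    [norm_sum_psi_lin], the terms missing a given slot can be erased without
    decreasing the norm, and doing this for every slot of [J] erases them all. *)
Lemma bias_top J h (S : finType) (d : S -> {set I}) (g : S -> X -> F) :
  multilin J h -> (forall s, multilin (d s) (g s)) -> (forall s, ~~ (J \subset d s)) ->
  `|\sum_x psi (h x + \sum_s g s x)| <= `|\sum_x psi (h x)|.
Proof.
move=> hJ gd Jd.
have key (l : seq I) : {subset l <= J} -> `|\sum_x psi (h x + \sum_s g s x)| <=
    `|\sum_x psi (h x + \sum_(s | all (mem (d s)) l) g s x)|.
  elim: l => [|i l IH] lJ; first by rewrite lexx.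
  apply: le_trans (IH _) _; first by move=> j jl; rewrite lJ // inE jl orbT.
  pose g1 x := \sum_(s | all (mem (d s)) l && (i \notin d s)) g s x.
  rewrite (eq_bigr (fun x =>
      psi (h x + \sum_(s | all (mem (d s)) (i :: l)) g s x + g1 x))).
    apply: (@norm_sum_psi_lin i).
      apply: lin_atDf; first by apply: hJ.1; apply: lJ; rewrite inE eqxx.
      by apply: lin_at_sum => s /= /andP[ids _]; apply: (gd s).1.
    by apply: indep_sum => s /andP[_]; apply: (gd s).2.
  move=> x _; congr psi; rewrite -addrA (bigID (fun s => i \in d s)) /=.
  by congr (_ + (_ + _)); apply: eq_bigl => s; rewrite andbC.
apply: le_trans (key (enum J) _) _; first by move=> i; rewrite mem_enum.
rewrite (eq_bigr (fun x => psi (h x))) // => x _.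
rewrite big_pred0 ?addr0 // => s; apply/negbTE; apply: contra (Jd s) => /allP h1.
by apply/subsetP => i iJ; apply: h1; rewrite mem_enum.
Qed.

(** Partition rank at most [D]. A nonzero linear form has no such decomposition at
    all, because a singleton has no nonempty proper subset. *)
Definition prank_le J (D : nat) h := exists (S : finType) (d : S -> {set I})
    (f g : S -> X -> F), [/\ (#|S| <= D)%N,
  forall s, d s != set0 /\ d s \proper J,
  forall s, multilin (d s) (f s) /\ multilin (J :\: d s) (g s) &
  forall x, h x = \sum_s f s x * g s x].

Lemma prank_le_leq J D D' h : (D <= D')%N -> prank_le J D h -> prank_le J D' h.
Proof.
move=> le [S [d [f [g [c p q e]]]]]; exists S, d, f, g.
by split=> //; apply: leq_trans le.
Qed.

Lemma eq_prank_le J D h g : h =1 g -> prank_le J D h -> prank_le J D g.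
Proof.
move=> e1 [S [d [f [k [c p q e]]]]]; exists S, d, f, k.
by split=> // x; rewrite -e1.
Qed.

(** Without division: the normalized exponential sum of [h] has norm at least
    [#|F| ^- r]. *)
Definition biased (r : nat) h :=
  (#|{: X}|%:R <= `|\sum_x psi (h x)| * #|F|%:R ^+ r).

End Multilinear.

(** * Squarefree polynomials and families of forms *)

Section MinDist.
Variables (F : finFieldType) (A : finType).
Implicit Types (y : {ffun A -> F}) (q : {set A} -> F).

Definition sqfree q y := \sum_(S : {set A}) q S * \prod_(j in S) y j.

(** If the monomial [B] is maximal for inclusion, it survives as the top monomial
    whatever values are given to the variables outside [B]; a polynomial of degree
    one in each of the variables of [B] with nonzero top coefficient is nonzero with
    probability at least [(1 - 1 / #|F|) ^ #|B| >= 2 ^- #|B|]. The event [P] allows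
    to condition on the variables outside [B]. *)
Lemma mindist (B : {set A}) q (P : pred {ffun A -> F}) :
  q B != 0 -> (forall S : {set A}, B \subset S -> q S != 0 -> S = B) ->
  (forall b y t, b \in B -> P (upd y b t) = P y) ->
  (#|[pred y | P y]| <= 2 ^ #|B| * #|[pred y | P y && (sqfree q y != 0%R)]|)%N.
Proof.
move: {2}#|B| (erefl #|B|) => k; elim: k B q => [|k IH] B q kB qB Bmax Pinv.
  move/cards0_eq: kB => B0; rewrite B0 in qB Bmax *.
  rewrite cards0 mul1n; apply: subset_leq_card; apply/subsetP => y.
  rewrite !inE => ->; rewrite /sqfree (bigD1 set0) //= big_set0 mulr1.
  rewrite big1 ?addr0 // => S S0; have [-> |qS] := eqVneq (q S) 0; first by rewrite mul0r.
  by rewrite (Bmax S) ?sub0set ?eqxx in S0.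
have [b bB] : exists b, b \in B by apply/card_gt0P; rewrite kB.
have kB1 : #|B :\ b| = k by move: kB; rewrite (cardsD1 b) bB => -[].
pose q1 (S : {set A}) := if b \notin S then q (b |: S) else 0.
pose q0 (S : {set A}) := if b \notin S then q S else 0.
have split y : sqfree q y = sqfree q0 y + y b * sqfree q1 y.
  rewrite /sqfree (bigID (fun S : {set A} => b \notin S)) /=; congr (_ + _).
    rewrite big_mkcond; apply: eq_bigr => S _; rewrite /q0; case: ifP => // _.
    by rewrite mul0r.
  rewrite big_distrr /= [RHS](bigID (fun S : {set A} => b \notin S)) /=.
  rewrite [X in _ = _ + X]big1 ?addr0; last first.
    by move=> S bS; rewrite /q1 (negPf bS) mul0r mulr0.
  rewrite (reindex_onto (fun S => b |: S) (fun S => S :\ b)) /=; last first.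
    by move=> S; rewrite negbK; apply: setD1K.
  apply: eq_big => S.
    rewrite setU11 /=; apply/eqP/idP => [<-|bS]; first by rewrite setD11.
    by rewrite setU1K.
  rewrite setU11 /= => /eqP bS; have {}bS : b \notin S by rewrite -bS setD11.
  by rewrite /q1 bS big_setU1 //= mulrCA.
have inv0 (q' : {set A} -> F) y t : (forall S : {set A}, b \in S -> q' S = 0) ->
    sqfree q' (upd y b t) = sqfree q' y.
  move=> q'0; apply: eq_bigr => S _; case: (boolP (b \in S)) => bS.
    by rewrite q'0 ?mul0r.
  congr (_ * _); apply: eq_bigr => j jS; rewrite updE; case: eqP => // jb.
  by rewrite -jb jS in bS.
have q1B : q1 (B :\ b) != 0 by rewrite /q1 setD11 setD1K.
have q1max (S : {set A}) : B :\ b \subset S -> q1 S != 0 -> S = B :\ b.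
  rewrite /q1; case: (boolP (b \in S)) => [_|bS]; first by rewrite eqxx.
  move=> sub /= qS; rewrite -(Bmax (b |: S)) ?setU1K //.
  by rewrite -subDset.
have Pinv1 c y t : c \in B :\ b -> P (upd y c t) = P y.
  by rewrite inE => /andP[_]; apply: Pinv.
apply: leq_trans (IH (B :\ b) q1 kB1 q1B q1max Pinv1) _.
rewrite kB1 kB expnS.
rewrite -mulnA mulnCA leq_mul2l; apply/orP; right.
(* Once [sqfree q1 y] is nonzero, resampling [y b] hits a root with probability
   [1 / #|F| <= 1 / 2]. *)
set N1 := #|_|; set N := #|_|.
have F2 : (1 < #|F|)%N := finNzRing_gt1 F.
have NF : (N * #|F| = \sum_y \sum_t
    ((P (upd y b t) && (sqfree q (upd y b t) != 0%R)) : nat))%N.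
  rewrite (sum_upd (fun y => (P y && (sqfree q y != 0%R)) : nat)).
  rewrite -[RHS]mulr_natr natn; congr (_ * _)%N.
  by rewrite /N -sum1_card big_mkcond; apply: eq_bigr => y _; rewrite inE; case: ifP.
suff : (N1 * (#|F| - 1) <= N * #|F|)%N.
  move=> le1; rewrite -(leq_pmul2r (m := #|F| - 1)) ?subn_gt0 //.
  apply: leq_trans le1 _; rewrite -mulnA mulnCA leq_mul2l; move: F2; clear; lia.
rewrite NF /N1 -sum1_card big_distrl big_mkcond /=.
apply: leq_sum => y _; case: ifP => // /andP[Py h1].
rewrite mul1n.
have E t : P (upd y b t) && (sqfree q (upd y b t) != 0) =
    (t != - sqfree q0 y / sqfree q1 y).
  rewrite Pinv // Py /= split !inv0 ?updE ?eqxx.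
  - rewrite addrC addr_eq0; congr (~~ _).
    by apply/eqP/eqP => [<-|->]; rewrite ?mulfK ?mulfVK.
  - by move=> S bS; rewrite /q1 bS.
  - by move=> S bS; rewrite /q0 bS.
under eq_bigr do rewrite E.
rewrite (bigD1 (- sqfree q0 y / sqfree q1 y)) //= eqxx add0n.
rewrite (eq_bigr (fun=> 1%N)) => [|t ->] //.
by rewrite sum1_card (cardC1 (- sqfree q0 y / sqfree q1 y)) subn1.
Qed.
End MinDist.

Section Generated.
Variables (F : finFieldType) (n : nat) (I : finType).
Notation V := 'rV[F]_n.
Notation X := {ffun I -> V}.
Implicit Types (J K : {set I}) (g h : X -> F).

(** What survives when a family is refined: if the old forms are generated by the new
    ones, so is everything that they generate ([gen_trans]). *)
Inductive generated (A : finType) (d : A -> {set I}) (f : A -> X -> F) :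
  {set I} -> (X -> F) -> Prop :=
| gen_base a : generated d f (d a) (f a)
| gen_mul J K g h of [disjoint J & K] & generated d f J g & generated d f K h :
    generated d f (J :|: K) (fun x => g x * h x)
| gen_lin J c g h of generated d f J g & generated d f J h :
    generated d f J (fun x => c * g x + h x)
| gen_0 J : generated d f J (fun=> 0)
| gen_ext J g h of g =1 h & generated d f J g : generated d f J h.

Lemma gen_trans (A B : finType) (dA : A -> {set I}) (dB : B -> {set I}) fA fB K h :
  (forall a, generated dB fB (dA a) (fA a)) -> generated dA fA K h -> generated dB fB K h.
Proof.
move=> AB; elim=> {K h} [a|J K g h dis _ gJ _ hK|J c g h _ gJ _ hJ|J|J g h e _ gJ].
- exact: AB.
- exact: gen_mul.
- exact: gen_lin.
- exact: gen_0.
- exact: gen_ext e gJ.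
Qed.

Lemma gen_sum (A S : finType) (d : A -> {set I}) f (P : pred S) (c : S -> F)
    (g : S -> X -> F) J :
  (forall s, P s -> generated d f J (g s)) -> generated d f J (fun x => \sum_(s | P s) c s * g s x).
Proof.
move=> gJ; elim: (index_enum S) => [|s l IH].
  by apply: gen_ext (gen_0 d f J) => x; rewrite big_nil.
case Ps: (P s).
  by apply: gen_ext (gen_lin (c s) (gJ s Ps) IH) => x; rewrite big_cons Ps.
by apply: gen_ext IH => x; rewrite big_cons Ps.
Qed.

Section Expr.
Variables (A : finType) (d : A -> {set I}) (f : A -> X -> F).
Implicit Types (S : {set A}).

(** The monomials that a form on [K] can involve: the slots of the factors partition
    [K]. *)
Definition tiles S K := (\bigcup_(a in S) d a == K) &&
  [forall a in S, forall b in S, (a != b) ==> [disjoint d a & d b]].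

Lemma tilesP S K : tiles S K -> \bigcup_(a in S) d a = K /\
  {in S &, forall a b, a != b -> [disjoint d a & d b]}.
Proof.
case/andP=> /eqP -> /forall_inP dis; split=> // a b aS bS ab.
by have /forall_inP/(_ b bS)/implyP := dis a aS; apply.
Qed.

Lemma tilesI S K : \bigcup_(a in S) d a = K ->
  {in S &, forall a b, a != b -> [disjoint d a & d b]} -> tiles S K.
Proof.
move=> e dis; rewrite /tiles e eqxx; apply/forall_inP => a aS.
by apply/forall_inP => b bS; apply/implyP => /(dis a b aS bS).
Qed.

Hypothesis d0 : forall a, d a != set0.

Lemma tiles_join S T J K : [disjoint J & K] -> tiles S J -> tiles T K ->
  [disjoint S & T] /\ tiles (S :|: T) (J :|: K).
Proof.
move=> dJK /tilesP[eS dS] /tilesP[eT dT].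
have cross a b : a \in S -> b \in T -> [disjoint d a & d b].
  move=> aS bT; apply: disjointWl (_ : d a \subset J) _.
    by rewrite -eS; apply: bigcup_sup.
  by apply: disjointWr _ dJK; rewrite -eT; apply: bigcup_sup.
split.
  rewrite -setI_eq0; apply/eqP/setP => a; rewrite !inE; apply/negbTE/andP => -[aS aT].
  have := cross a a aS aT; rewrite -setI_eq0 setIid; exact/negP.
apply: tilesI; first by rewrite bigcup_setU eS eT.
move=> a b; rewrite !inE => /orP[aS|aT] /orP[bS|bT]; [exact: dS| | |exact: dT].
  by move=> _; apply: cross.
by move=> _; rewrite disjoint_sym; apply: cross.
Qed.

(** Two comparable monomials of the same form coincide, so each monomial is maximal
    and [mindist] applies to it. *)
Lemma tiles_sub S T K : tiles S K -> tiles T K -> S \subset T -> T = S.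
Proof.
move=> /tilesP[eS _] /tilesP[eT dT] sub; apply/eqP; rewrite eqEsubset sub andbT.
apply/subsetP => a aT; have /set0Pn[i ia] := d0 a.
have : i \in K by rewrite -eT; apply/bigcupP; exists a.
rewrite -eS => /bigcupP[b bS ib]; have [<- // | ab] := eqVneq b a.
have := dT b a (subsetP sub b bS) aT ab.
by rewrite -setI_eq0 => /eqP/setP/(_ i); rewrite !inE ia ib.
Qed.

Lemma tiles_card S K : tiles S K -> (#|S| <= #|K|)%N.
Proof.
move=> /tilesP[eS dS].
have ex a : exists i, i \in d a by apply/set0Pn.
pose pt a := xchoose (ex a).
have ptP a : pt a \in d a by apply: xchooseP.
rewrite -(card_in_imset (f := pt)).
  apply: subset_leq_card; apply/subsetP => i /imsetP[a aS ->].
  by rewrite -eS; apply/bigcupP; exists a.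
move=> a b aS bS e; apply/eqP; apply: contraT => /(dS a b aS bS).
by rewrite -setI_eq0 => /eqP/setP/(_ (pt a)); rewrite !inE ptP e ptP.
Qed.

(** The atoms of the family are the fibres of this map. *)
Definition val_at x : {ffun A -> F} := [ffun a => f a x].

Lemma sqfree_val (q : {set A} -> F) x :
  sqfree q (val_at x) = \sum_(S : {set A}) q S * \prod_(a in S) f a x.
Proof.
by apply: eq_bigr => S _; congr (_ * _); apply: eq_bigr => a _; rewrite ffunE.
Qed.

Lemma gen_expr K h : generated d f K h -> exists q : {set A} -> F,
  (forall S, q S != 0 -> tiles S K) /\ forall x, h x = sqfree q (val_at x).
Proof.
elim=> {K h} [a|J K g h dis _ [q1 [t1 e1]] _ [q2 [t2 e2]]
  |J c g h _ [q1 [t1 e1]] _ [q2 [t2 e2]]|J|J g h e _ [q [t1 e1]]].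
- exists (fun S => (S == [set a])%:R); split=> [S|x].
    case: (S =P [set a]) => [-> _|_]; last by rewrite eqxx.
    by apply: tilesI => [|b c]; rewrite ?big_set1 // !inE => /eqP -> /eqP ->; rewrite eqxx.
  rewrite sqfree_val (bigD1 [set a]) //= eqxx mul1r big_set1 big1 ?addr0 // => S.
  by move=> /negPf ->; rewrite mul0r.
- exists (fun S => \sum_(p : {set A} * {set A} | p.1 :|: p.2 == S) q1 p.1 * q2 p.2).
  split=> [S|x].
    case: (pickP [pred p : {set A} * {set A} | (p.1 :|: p.2 == S) &&
       (q1 p.1 * q2 p.2 != 0)]) => [[S1 S2] /= /andP[/eqP <-]|no].
      rewrite mulf_eq0 negb_or => /andP[/t1 ? /t2 ? _].
      by case: (@tiles_join S1 S2 J K).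
    rewrite big1 ?eqxx // => p pS; apply/eqP; have /negbT := no p.
    by rewrite /= pS negbK.
  rewrite e1 e2 !sqfree_val big_distrlr pair_big /=.
  rewrite (partition_big (fun p => p.1 :|: p.2) xpredT) //=.
  apply: eq_bigr => S _; rewrite big_distrl /=; apply: eq_bigr => -[S1 S2] /= /eqP <-.
  have [->|/t1 n1] := eqVneq (q1 S1) 0; first by rewrite !mul0r.
  have [->|/t2 n2] := eqVneq (q2 S2) 0; first by rewrite !(mulr0, mul0r).
  have [dS _] := tiles_join dis n1 n2.
  rewrite mulrACA; congr (_ * _); rewrite -bigU //=.
  by apply: eq_bigl => a; rewrite !inE.
- exists (fun S => c * q1 S + q2 S); split=> [S|x].
    have [->|/t1 //] := eqVneq (q1 S) 0; rewrite mulr0 add0r; exact: t2.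
  rewrite e1 e2 !sqfree_val big_distrr -big_split /=; apply: eq_bigr => S _.
  by rewrite mulrDl mulrA.
- exists (fun=> 0); split=> [S|x]; first by rewrite eqxx.
  by rewrite sqfree_val big1 // => S _; rewrite mul0r.
by exists q; split=> // x; rewrite -e.
Qed.

Variables (C : numClosedFieldType) (psi : F -> C).
Hypothesis psiP : addchar psi.

(** Fourier inversion: the size of an atom is the average over [a] of the exponential
    sums of [a . f]; the term [a = 0] gives the expected size, and the others
    together contribute at most [#|F| ^- 2 <= 1 / 4] of it. *)
Lemma equidistributed :
  (forall a : {ffun A -> F}, a != [ffun=> 0] ->
    `|\sum_x psi (\sum_j a j * f j x)| * #|F|%:R ^+ #|A|.+2 <= #|{: X}|%:R) ->
  forall y, (3 * #|{: X}| <= 4 * #|F| ^ #|A| * #|[pred x | val_at x == y]| <= 5 * #|{: X}|)%N.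
Proof.
move=> small y; set N := #|[pred x | val_at x == y]|.
have F2 : (1 < #|F|)%N := finNzRing_gt1 F.
have F0 : (0 : C) < #|F|%:R by rewrite ltr0n; apply: ltnW.
have NE : N%:R = \sum_x (val_at x == y)%:R :> C.
  rewrite /N -sum1_card natr_sum big_mkcond; apply: eq_bigr => x _.
  by rewrite inE; case: eqP.
have E : (#|F| ^ #|A|)%:R * N%:R =
   \sum_(a : {ffun A -> F}) psi (- \sum_j a j * y j) * \sum_x psi (\sum_j a j * f j x).
  under eq_bigr do rewrite big_distrr.
  rewrite exchange_big /= NE big_distrr /=; apply: eq_bigr => x _.
  transitivity (\sum_(a : {ffun A -> F}) psi (\sum_j a j * (val_at x - y) j)).
    rewrite (sum_psi_dot psiP).
    suff -> : (val_at x - y == [ffun=> 0]) = (val_at x == y).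
      by case: eqP; rewrite ?mulr1 ?mulr0.
    by rewrite -[LHS]subr_eq0 -[RHS]subr_eq0; congr (_ == _);
       apply/ffunP => j; rewrite !ffunE ?subr0.
  apply: eq_bigr => a _; rewrite -(psiD psiP); congr psi.
  rewrite [RHS]addrC -sumrB; apply: eq_bigr => j _; rewrite !ffunE.
  by rewrite mulrBr.
have err : `|(#|F| ^ #|A|)%:R * N%:R - #|{: X}|%:R| * 4 <= (#|{: X}|%:R : C).
  rewrite E (bigD1 [ffun=> 0]) //= big1 ?oppr0 => [|j _]; last by rewrite ffunE mul0r.
  rewrite (psi0 psiP) mul1r (eq_bigr (fun=> 1)) => [|x _]; last first.
    by rewrite big1 ?(psi0 psiP) // => j _; rewrite ffunE mul0r.
  rewrite sumr_const addrAC subrr add0r.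
  have le4 : (4 : C) <= #|F|%:R ^+ 2 by rewrite -natrX ler_nat; nia.
  apply: le_trans (ler_wpM2l (normr_ge0 _) le4) _.
  have c0 : (0 : C) < (#|F| ^ #|A|)%:R by rewrite natrX exprn_gt0.
  rewrite -(ler_pM2l c0).
  apply: le_trans (_ : \sum_(a : {ffun A -> F} | a != [ffun=> 0]) #|{: X}|%:R <= _).
    rewrite mulrCA natrX -exprD addn2.
    apply: le_trans (ler_wpM2r _ (ler_norm_sum _ _ _)) _.
      by rewrite exprn_ge0 // ltW.
    rewrite big_distrl /=; apply: ler_sum => a /small.
    by rewrite normrM (psi_norm psiP) mul1r.
  rewrite sumr_const -[X in X <= _]mulr_natl ler_wpM2r ?ler0n // ler_nat.
  by apply: leq_trans (max_card _) _; rewrite card_ffun.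
move: err; rewrite -natrM -mulnA; move: (_ * N)%N #|{: X}| => a b.
have [h|/ltnW h] := leqP b a; last (rewrite distrC).
  by rewrite -natrB // normr_nat -natrM ler_nat; lia.
by rewrite -natrB // normr_nat -natrM ler_nat; lia.
Qed.

End Expr.

Section Ideal.
Variables (A B : finType) (dA : A -> {set I}) (dB : B -> {set I}).
Variables (fA : A -> X -> F) (fB : B -> X -> F).

Definition joinf (T : Type) (u : A -> T) (v : B -> T) (s : A + B) : T :=
  match s with inl a => u a | inr b => v b end.

Notation d := (joinf dA dB).
Notation f := (joinf fA fB).

Hypothesis d0 : forall s, d s != set0.

(** A form that vanishes on almost all of one atom of the first family has no
    monomial supported on the second family alone. Otherwise, with the values of the
    first family frozen at [c], the polynomial [q] would be nonzero for a proportion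
    [2 ^- k] of the values of the second family ([mindist]); equidistribution
    transfers this to the atom, up to a factor [3 / 5 > 1 / 2]. *)
Lemma atom_ideal (k : nat) K (q : {set (A + B)%type} -> F) (c : A -> F) :
  (#|K| <= k)%N -> (forall S, q S != 0 -> tiles d S K) ->
  (forall y, (3 * #|{: X}| <= 4 * #|F| ^ #|{: A + B}| * #|[pred x | val_at f x == y]|
     <= 5 * #|{: X}|)%N) ->
  (2 ^ k.+1 * #|[pred x | [forall a, fA a x == c a] && (sqfree q (val_at f x) != 0%R)]|
    <= #|[pred x | [forall a, fA a x == c a]]|)%N ->
  forall S, q S != 0 -> exists a, inl a \in S.
Proof.
move=> Kk qt eq few S qS; apply/existsP; apply: contraT.
rewrite negb_exists => /forallP noA.
pose P (y : {ffun A + B -> F}) := [forall a, y (inl a) == c a].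
have Pinv b y t : b \in S -> P (upd y b t) = P y.
  move=> bS; apply: eq_forallb => a; rewrite updE; case: (inl a =P b) => // ab.
  by rewrite -ab (negPf (noA a)) in bS.
have Smax (T : {set (A + B)%type}) : S \subset T -> q T != 0 -> T = S.
  by move=> ST /qt tT; apply: (tiles_sub d0 (qt S qS) tT ST).
have md := mindist qS Smax Pinv.
have le_k : (2 ^ #|S| <= 2 ^ k)%N.
  by rewrite leq_exp2l //; apply: leq_trans (tiles_card d0 (qt S qS)) Kk.
have fib (Q : pred {ffun A + B -> F}) :
    (#|[pred x | Q (val_at f x)]| = \sum_(y | Q y) #|[pred x | val_at f x == y]|)%N.
  rewrite -sum1_card (partition_big (val_at f) Q) //=.
  apply: eq_bigr => y Qy; rewrite -sum1_card; apply: eq_bigl => x /=.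
  by rewrite !inE andbC; case: eqP => // ->.
have PE x : [forall a, fA a x == c a] = P (val_at f x).
  by apply: eq_forallb => a; rewrite ffunE.
move: few; set few := #|_|; set all := #|_|.
have -> : few = (\sum_(y | P y && (sqfree q y != 0%R)) #|[pred x | val_at f x == y]|)%N.
  by rewrite -fib; apply: eq_card => x; rewrite !inE PE.
have -> : all = (\sum_(y | P y) #|[pred x | val_at f x == y]|)%N.
  by rewrite -fib; apply: eq_card => x; rewrite !inE PE.
set a1 := (\sum_(y | _) _)%N; set a2 := (\sum_(y | _) _)%N.
have X0 : (0 < #|{: X}|)%N by apply/card_gt0P; exists [ffun=> 0].
have P0 : (0 < #|[pred y | P y]|)%N.
  apply/card_gt0P; exists [ffun s => joinf c (fun=> 0) s].
  by apply/forallP => a; rewrite ffunE.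
have l1 : (3 * #|{: X}| * #|[pred y | P y && (sqfree q y != 0%R)]|
    <= 4 * #|F| ^ #|{: A + B}| * a1)%N.
  rewrite -[X in (_ * X <= _)%N]sum1_card !big_distrr /=; apply: leq_sum => y _; rewrite muln1.
  by have /andP[] := eq y.
have l2 : (4 * #|F| ^ #|{: A + B}| * a2 <= 5 * #|{: X}| * #|[pred y | P y]|)%N.
  rewrite -[X in (_ <= _ * X)%N]sum1_card !big_distrr /=; apply: leq_sum => y _; rewrite muln1.
  by have /andP[] := eq y.
move: md l1 l2 X0 P0 le_k; rewrite expnS.
set p1 := #|[pred y | P y]|; set p2 := #|[pred y | P y & _]|.
move: (4 * _)%N (#|{: X}|) (2 ^ #|S|)%N (2 ^ k)%N => e x t' t md l1 l2 x0 p0 tt' le12.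
have m1 : (p1 <= t * p2)%N by apply: leq_trans md _; rewrite leq_mul2r tt' orbT.
have m2 : (6 * x * p1 <= 2 * t * (3 * x * p2))%N.
  by rewrite (_ : 2 * t * (3 * x * p2) = 6 * x * (t * p2))%N ?leq_mul2l ?m1 ?orbT //; ring.
have m3 : (2 * t * (3 * x * p2) <= 2 * t * (e * a1))%N by rewrite leq_mul2l l1 orbT.
have m4 : (e * (2 * t * a1) <= e * a2)%N by rewrite leq_mul2l le12 orbT.
have := leq_trans (leq_trans m2 m3) (leq_trans _ (leq_trans m4 l2)).
rewrite mulnCA leqnn => /(_ isT).
by rewrite leq_pmul2r // leq_pmul2r.
Qed.

Hypotheses (lA : forall a, multilin (dA a) (fA a)) (lB : forall b, multilin (dB b) (fB b)).

(** Each monomial is charged to one of its factors in the first family. *)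
Lemma ideal_split K (q : {set (A + B)%type} -> F) h :
  (forall S, q S != 0 -> tiles d S K) ->
  (forall S, q S != 0 -> exists a, inl a \in S) ->
  (forall x, h x = sqfree q (val_at f x)) ->
  exists G : A -> X -> F, (forall a, multilin (K :\: dA a) (G a)) /\
    forall x, h x = \sum_(a | dA a \subset K) fA a x * G a x.
Proof.
move=> qt qA hq.
have lf s : multilin (d s) (f s) by case: s => [a|b]; [exact: lA | exact: lB].
pose pA (S : {set (A + B)%type}) := [pick a | inl a \in S].
exists (fun a x => \sum_(S | pA S == Some a) q S * \prod_(s in S :\ inl a) f s x).
split=> [a|x].
  apply: multilin_sum => S /eqP; rewrite /pA; case: pickP => // b bS [eb].
  rewrite {b}eb in bS.
  have [q0|/qt/tilesP[eS dS]] := eqVneq (q S) 0.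
    by apply: eq_multilin (@multilin0 F n I _) => x; rewrite q0 mul0r.
  have -> : K :\: dA a = \bigcup_(s in S :\ inl a) d s.
    apply/setP => i; rewrite inE -eS; apply/andP/bigcupP.
      move=> [ia /bigcupP[s sS is_]]; exists s => //; rewrite !inE sS andbT.
      by apply: contra ia => /eqP es; rewrite es in is_.
    move=> [s]; rewrite !inE => /andP[sa sS] is_; split; last by apply/bigcupP; exists s.
    have := dS s (inl a) sS bS sa; rewrite -setI_eq0 => /eqP/setP/(_ i).
    by rewrite !inE is_ /= => ->.
  apply: multilin_scale; apply: multilin_prod => // s t; rewrite !inE => /andP[_ sS] /andP[_ tS].
  exact: dS.
rewrite hq sqfree_val (bigID (fun S => pA S != None)) /= [X in _ + X]big1 ?addr0; last first.
  move=> S; rewrite negbK /pA; case: pickP => // no _.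
  have [->|/qA[a aS]] := eqVneq (q S) 0; first by rewrite mul0r.
  by have := no a; rewrite aS.
rewrite (eq_bigr (fun S => \sum_(a | pA S == Some a) q S * \prod_(s in S) f s x)); last first.
  move=> S; rewrite /pA; case: pickP => // a _ _.
  by rewrite (big_pred1 a) // => b; rewrite eq_sym.
rewrite (exchange_big_dep xpredT) //= [RHS]big_mkcond; apply: eq_bigr => a _.
case: ifPn => aK.
  rewrite big_distrr /=; apply: eq_big => S.
    by case: (pA S).
  case/andP=> _; rewrite /pA; case: pickP => // b bS /eqP[eb]; rewrite {b}eb in bS.
  by rewrite (big_setD1 (inl a)) //= mulrCA.
rewrite big1 // => S /andP[_]; rewrite /pA; case: pickP => // b bS /eqP[eb].
rewrite {b}eb in bS; have [->|/qt/tilesP[eS _]] := eqVneq (q S) 0; first by rewrite mul0r.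
by case/negP: aK; rewrite -eS; apply: (bigcup_sup (inl a)).
Qed.

End Ideal.

End Generated.

(** * Regularization *)

Lemma bounded_ex (P : nat -> nat -> Prop) :
  (forall c N N', (N <= N')%N -> P c N -> P c N') -> (forall c, exists N, P c N) ->
  forall v, exists N, forall c, (c <= v)%N -> P c N.
Proof.
move=> mono ex; elim=> [|v [N IH]].
  by have [N PN] := ex 0%N; exists N => c; rewrite leqn0 => /eqP ->.
have [M PM] := ex v.+1; exists (maxn N M) => c.
rewrite leq_eqVlt => /orP[/eqP -> | /IH PN].
  exact: mono (leq_maxr _ _) PM.
exact: mono (leq_maxl _ _) PN.
Qed.

Section Regular.
Variables (F : finFieldType) (n : nat) (I : finType).
Notation V := 'rV[F]_n.
Notation X := {ffun I -> V}.

Definition level_comb (A : finType) (d : A -> {set I}) (f : A -> X -> F) J (a : A -> F) x :=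
  \sum_(j | d j == J) a j * f j x.

(** No combination on common slots has small partition rank, unless it only involves
    the family [A], which is kept fixed. *)
Definition rel_regular D (A B : finType) (dA : A -> {set I}) (fA : A -> X -> F)
    (dB : B -> {set I}) (fB : B -> X -> F) :=
  forall J a b, prank_le J D (fun x => level_comb dA fA J a x + level_comb dB fB J b x) ->
    forall j, dB j = J -> b j = 0.

Definition graded k (A : finType) (d : A -> {set I}) (f : A -> X -> F) :=
  forall a, [/\ d a != set0, (#|d a| <= k)%N & multilin (d a) (f a)].

End Regular.

(** Regularization for families with exactly [c] forms of top order [k.+1], listed
    separately from those of lower order. *)
Definition top_regularizable (I : finType) k (rho : nat -> nat) c v N :=
  forall (F : finFieldType) n (A : finType) (dA : A -> {set I})
    (fA : A -> {ffun I -> 'rV[F]_n} -> F)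
    (dH : 'I_c -> {set I}) fH (L : finType) (dL : L -> {set I}) fL,
  (forall h, #|dH h| = k.+1 /\ multilin (dH h) (fH h)) -> graded k dL fL -> (#|L| <= v)%N ->
  exists (L' : finType) (dL' : L' -> {set I}) fL', [/\ graded k.+1 dL' fL',
    (#|L'| <= N)%N, rel_regular (rho #|L'|) dA fA dL' fL',
    forall h, generated (joinf dA dL') (joinf fA fL') (dH h) (fH h) &
    forall l, generated (joinf dA dL') (joinf fA fL') (dL l) (fL l)].

(** The bound [N] is uniform in the field, the dimension and the fixed family; the
    rank requirement [rho] may depend on the size of the refined family. *)
Definition regularizable (I : finType) k :=
  forall (rho : nat -> nat) v, exists N,
  forall (F : finFieldType) n (A : finType) (dA : A -> {set I})
    (fA : A -> {ffun I -> 'rV[F]_n} -> F) (L : finType) (dL : L -> {set I}) fL,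
  graded k dL fL -> (#|L| <= v)%N ->
  exists (L' : finType) (dL' : L' -> {set I}) fL', [/\ graded k dL' fL',
    (#|L'| <= N)%N, rel_regular (rho #|L'|) dA fA dL' fL' &
    forall l, generated (joinf dA dL') (joinf fA fL') (dL l) (fL l)].

(** First regularize the lower forms, the top ones being kept fixed. If the result is
    not regular, the offending combination involves a top form, which it expresses
    through the other forms and boundedly many forms of lower order; so that top form
    can be dropped, and [c] decreases. *)
Lemma regular_top (I : finType) k : regularizable I k ->
  forall rho c v, exists N, top_regularizable I k rho c v N.
Proof.
move=> reg rho; elim=> [|c IH] v.
  have [N0 regN0] := reg rho v.
  exists N0 => F n A dA fA dH fH L dL fL Hk gL Lv.
  have [L' [dL' [fL' [g' N' r' e']]]] := regN0 F n A dA fA L dL fL gL Lv.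
  exists L', dL', fL'; split=> //; last by case.
  by move=> a; have [? ? ?] := g' a; split=> //; apply: leqW.
have [N0 regN0] := reg (fun N => rho (c.+1 + N)%N) v.
pose m := (\max_(i < N0.+1) rho (c.+1 + i)%N)%N.
have [N1 regN1] := IH (N0 + (m + m))%N.
exists (maxn (c.+1 + N0) N1) => F n A dA fA dH fH L dL fL Hk gL Lv.
have [L1 [dL1 [fL1 [g1 c1 r1 e1]]]] :=
  regN0 F n (A + 'I_c.+1)%type (joinf dA dH) (joinf fA fH) L dL fL gL Lv.
case: (EM (exists J a b j, [/\ prank_le J (rho (c.+1 + #|L1|)%N)
    (fun x => level_comb dA fA J a x + level_comb (joinf dH dL1) (joinf fH fL1) J b x),
    joinf dH dL1 j = J & b j != 0])) => [|no]; last first.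
  exists ('I_c.+1 + L1)%type, (joinf dH dL1), (joinf fH fL1); split.
  - case=> [h|l] /=; last by have [? ? ?] := g1 l; split=> //; apply: leqW.
    by have [hk ?] := Hk h; split=> //; rewrite ?hk // -card_gt0 hk.
  - by rewrite card_sum card_ord leq_max leq_add2l c1.
  - move=> J a b; rewrite card_sum card_ord => pk j dj; apply/eqP; apply: contraT => bj.
    by case: no; exists J, a, b, j.
  - by move=> h; apply: (gen_base (joinf dA (joinf dH dL1)) _ (inr (inl h))).
  move=> l; apply: gen_trans (e1 l) => -[[a|h]|l'].
  - exact: (gen_base (joinf dA (joinf dH dL1)) _ (inl a)).
  - exact: (gen_base (joinf dA (joinf dH dL1)) _ (inr (inl h))).
  - exact: (gen_base (joinf dA (joinf dH dL1)) _ (inr (inr l'))).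
move=> [J [a [b [[h|l] [pk /= dj bj]]]]]; last first.
  case/eqP: bj; apply: (r1 J (joinf a (fun h => b (inl h))) (fun l => b (inr l)) _ l dj).
  by apply: eq_prank_le pk => x; rewrite /level_comb !big_sumType /= addrA.
have Jk : #|J| = k.+1 by rewrite -dj; apply: (Hk h).1.
case: pk => S [d [f [g [Sm dS fS eS]]]].
have {}Sm : (#|S| <= m)%N.
  apply: leq_trans Sm _.
  exact: (@leq_bigmax 'I_N0.+1 (fun i => rho (c.+1 + i)%N) (Ordinal (c1 : #|L1| < N0.+1)%N)).
pose dL2 := joinf dL1 (joinf d (fun s => J :\: d s)).
pose fL2 := joinf fL1 (joinf f g).
have g2 : graded k dL2 fL2.
  case=> [l|[s|s]] /=; first exact: g1.
    have [d0 dJ] := dS s; have [fs _] := fS s; split=> //.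
    by rewrite -ltnS -Jk proper_card.
  have [d0 dJ] := dS s; have [_ gs] := fS s; split=> //.
    by rewrite setD_eq0; move: dJ; rewrite properE => /andP[].
  have := cardsID (d s) J; rewrite Jk (setIidPr (proper_sub dJ)).
  by move: d0; rewrite -card_gt0; lia.
have c2 : (#|{: L1 + (S + S)}| <= N0 + (m + m))%N.
  by rewrite !card_sum leq_add ?leq_add.
have Hk' i : #|(dH \o lift h) i| = k.+1 /\ multilin ((dH \o lift h) i) ((fH \o lift h) i).
  exact: Hk.
have [L' [dL' [fL' [g' c' r' eH' e']]]] := regN1 F n A dA fA _ _ _ _ _ Hk' g2 c2.
have eA a' : generated (joinf dA dL') (joinf fA fL') (dA a') (fA a').
  exact: (gen_base (joinf dA dL') (joinf fA fL') (inl a')).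
have eHn i : i != h -> generated (joinf dA dL') (joinf fA fL') (dH i) (fH i).
  rewrite eq_sym; case: (unliftP h i) => [i' ->|->]; last by rewrite eqxx.
  by move=> _; apply: eH'.
(* The top form [h] is recovered from the combination of small partition rank. *)
have eh : generated (joinf dA dL') (joinf fA fL') (dH h) (fH h).
  have gS : generated (joinf dA dL') (joinf fA fL') J (fun x => \sum_s 1 * (f s x * g s x)).
    apply: gen_sum => s _.
    have -> : J = d s :|: (J :\: d s).
      by rewrite -{1}(setID J (d s)) (setIidPr (proper_sub (dS s).2)).
    apply: gen_mul (e' (inr (inl s))) (e' (inr (inr s))).
    by rewrite -setI_eq0 setIDA setDIl setDv set0I.
  have gA : generated (joinf dA dL') (joinf fA fL') J (level_comb dA fA J a).
    by apply: gen_sum => a' /eqP <-.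
  have gH : generated (joinf dA dL') (joinf fA fL') J
      (fun x => \sum_(i | (dH i == J) && (i != h)) b (inl i) * fH i x).
    by apply: gen_sum => i /andP[/eqP <-]; apply: eHn.
  have g3 := gen_lin (-1) gH (gen_lin (-1) gA gS).
  rewrite dj; apply: gen_ext (gen_lin (b (inl h))^-1 g3 (gen_0 _ _ J)) => x /=.
  under [\sum_s _]eq_bigr do rewrite mul1r.
  have L10 : \sum_(l | dL1 l == J) b (inr l) * fL1 l x = 0.
    by apply: big1 => l /eqP lJ; have [_ + _] := g1 l; rewrite lJ Jk ltnn.
  rewrite -eS /level_comb big_sumType /= L10 !addr0.
  rewrite [in X in _ + (_ + X)](bigD1 h) ?dj ?eqxx //=.
  rewrite (mulN1r (level_comb _ _ _ _ _)) addKr mulN1r [X in _ + X]addrC addKr.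
  by rewrite mulKf.
exists L', dL', fL'; split=> //.
- by apply: leq_trans c' (leq_maxr _ _).
- by move=> i; have [-> //|/eHn] := eqVneq i h.
move=> l; apply: gen_trans (e1 l) => -[[a'|i]|l'] /=.
- exact: eA.
- by have [-> //|/eHn] := eqVneq i h.
- exact: (e' (inl l')).
Qed.

Lemma regularize (I : finType) k : regularizable I k.
Proof.
elim: k => [|k IH] rho v.
  exists 0%N => F n A dA fA L dL fL gL Lv.
  have noL (l : L) : False.
    by have [+ + _] := gL l; rewrite -card_gt0; case: #|_|.
  have L0 : #|L| = 0%N by apply: eq_card0 => l; case: (noL l).
  exists L, dL, fL; rewrite L0; split=> //.
have [|N HN] := @bounded_ex (fun c N => top_regularizable I k rho c v N) _
   (fun c => regular_top IH rho c v) v.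
  move=> c N N' NN' HN F n A dA fA dH fH L dL fL h1 h2 h3.
  have [L' [dL' [fL' [? ? ? ? ?]]]] := HN F n A dA fA dH fH L dL fL h1 h2 h3.
  by exists L', dL', fL'; split=> //; apply: leq_trans NN'.
exists N => F n A dA fA L dL fL gL Lv.
pose H := {l : L | #|dL l| == k.+1}; pose L0 := {l : L | (#|dL l| <= k)%N}.
have cH : (#|{: H}| <= v)%N by apply: leq_trans Lv; rewrite card_sig max_card.
have cL0 : (#|{: L0}| <= v)%N by apply: leq_trans Lv; rewrite card_sig max_card.
have [||L' [dL' [fL' [g' c' r' eH eL]]]] := HN _ cH F n A dA fA
   (fun h => dL (val (enum_val h : H))) (fun h => fL (val (enum_val h : H)))
   L0 (fun l => dL (val l)) (fun l => fL (val l)) _ _ cL0.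
- move=> h; case: (enum_val h) => l /= /eqP lk; split=> //.
  by have [_ _] := gL l.
- by case=> l lk /=; have [? _ ?] := gL l; split.
exists L', dL', fL'; split=> // l.
have [_ + _] := gL l; rewrite leq_eqVlt => /orP[lk|lk]; last exact: (eL (Sub l lk)).
by have := eH (enum_rank (Sub l lk : H)); rewrite enum_rankK.
Qed.

(** * Slices of a biased form *)

Section Step.
Variables (F : finFieldType) (n : nat) (I : finType).
Notation V := 'rV[F]_n.
Notation X := {ffun I -> V}.
Variables (C : numClosedFieldType) (psi : F -> C).
Hypothesis psiP : addchar psi.
Implicit Types (J K : {set I}).

Lemma card_ker (l : V -> F) : (forall a u v, l (a *: u + v) = a * l u + l v) ->
  ~~ [forall u, l u == 0] -> (#|[pred v | l v == 0%R]| * #|F| <= #|{: V}|)%N.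
Proof.
move=> ll; rewrite negb_forall => /existsP[u lu].
rewrite -cardX -(card_in_imset (f := fun p : V * F => p.1 + p.2 *: u)); first exact: max_card.
have lE p : l (p.1 + p.2 *: u) = p.2 * l u + l p.1 by rewrite addrC ll.
move=> [v a] [w b]; rewrite !inE /= !andbT => /eqP lv /eqP lw e.
have := congr1 l e; rewrite (lE (v, a)) (lE (w, b)) /= lv lw !addr0 => /(mulIf lu) ab.
by move: e; rewrite ab => /addIr ->.
Qed.

Section Slices.
Variables (J : {set I}) (i : I) (T : X -> F).
Hypotheses (iJ : i \in J) (lT : multilin J T).

Definition slice (u : V) (x : X) := T (upd x i u).

Lemma slice_lin x a u v : slice (a *: u + v) x = a * slice u x + slice v x.
Proof. exact: lT.1. Qed.

Lemma multilin_slice u : multilin (J :\ i) (slice u).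
Proof.
split=> j; rewrite !inE.
  case/andP=> ji jJ x a v w; rewrite /slice !(@updC _ _ _ j i) //.
  exact: lT.1.
rewrite negb_and negbK; have [-> _ x v | ji /= jJ x v] := eqVneq j i.
  by rewrite /slice upd_upd.
by rewrite /slice updC // lT.2.
Qed.

Definition common_zero x := zero_at i T x.

Lemma card_common_zero r : biased psi r T ->
  (#|{: X}| <= #|[pred x | common_zero x]| * #|F| ^ r)%N.
Proof.
rewrite /biased (sum_psi_lin_card psiP (lT.1 i iJ)) normr_nat -natrX -natrM.
by rewrite ler_nat.
Qed.

Section Sample.
Variables (m : nat) (u : {ffun 'I_m -> V}).

Definition sampled_zero x := [forall j, slice (u j) x == 0].

Lemma common_sampled x : common_zero x -> sampled_zero x.
Proof. by move=> /forallP xZ; apply/forallP => j; apply: xZ. Qed.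

End Sample.

(** A random slice vanishes at a point outside the common zero set with probability
    at most [1 / #|F|], so some choice of [m] slices leaves only a proportion
    [#|F| ^- m] of such points. *)
Lemma sampling m : exists u : {ffun 'I_m -> V},
  (#|[pred x | sampled_zero u x && ~~ common_zero x]| * #|F| ^ m <= #|{: X}|)%N.
Proof.
apply: contrapT => /forallNP no.
pose bad (u : {ffun 'I_m -> V}) := #|[pred x | sampled_zero u x && ~~ common_zero x]|.
have lt : (\sum_(u : {ffun 'I_m -> V}) #|{: X}| < \sum_u bad u * #|F| ^ m)%N.
  rewrite [X in (_ < X)%N](bigD1 [ffun=> 0]) //= (bigD1 [ffun=> 0]) //= -addSn.
  apply: leq_add; first by rewrite ltnNge; apply/negP/no.
  by apply: leq_sum => u _; apply: ltnW; rewrite ltnNge; apply/negP/no.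
move: lt; rewrite ltnNge => /negP; apply.
rewrite sum_nat_const card_ffun card_ord -big_distrl /=.
have -> : (\sum_u bad u = \sum_(x | ~~ common_zero x)
    #|[pred u : {ffun 'I_m -> V} | sampled_zero u x]|)%N.
  transitivity (\sum_(u : {ffun 'I_m -> V}) \sum_(x | ~~ common_zero x) sampled_zero u x)%N.
    apply: eq_bigr => u _; rewrite /bad -sum1_card big_mkcond [RHS]big_mkcond /=.
    by apply: eq_bigr => x _; rewrite inE; case: ifP; case: common_zero; case: sampled_zero.
  rewrite exchange_big; apply: eq_bigr => x _; rewrite -sum1_card [RHS]big_mkcond /=.
  by apply: eq_bigr => u _; rewrite inE; case: sampled_zero.
rewrite big_distrl /= mulnC -sum_nat_const.
apply: leq_trans (_ : \sum_(x | ~~ common_zero x) #|{: V}| ^ m <= _)%N; last first.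
  by rewrite !sum_nat_const leq_mul2r max_card orbT.
apply: leq_sum => x xZ.
have -> : #|[pred u : {ffun 'I_m -> V} | sampled_zero u x]| =
    (#|[pred v | slice v x == 0%R]| ^ m)%N.
  rewrite -[X in (_ ^ X)%N](card_ord m) -[RHS]card_ffun_on; apply: eq_card => u.
  rewrite [LHS]inE.
  by apply/forallP/ffun_onP => h j; have := h j; rewrite inE.
rewrite -expnMn; have [->|m0] := posnP m; first by rewrite !expn0.
by rewrite leq_exp2r //; apply: card_ker => // a v w; apply: slice_lin.
Qed.

(** Any slice is 0 on the common zeros, which fill at least half of the sampled zeros,
    so it correlates with their indicator function; expanding the latter in characters
    of the sampled slices gives a biased combination. *)
Lemma slice_biased r m (u : {ffun 'I_m -> V}) (v : V) :
  biased psi r T ->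
  (2 * #|[pred x | sampled_zero u x && ~~ common_zero x]|
     <= #|[pred x | common_zero x]|)%N ->
  exists a : {ffun 'I_m -> F},
    biased psi r.+1 (fun x => slice v x + \sum_j a j * slice (u j) x).
Proof.
move=> /card_common_zero Zr half.
pose z := #|[pred x | common_zero x]|.
pose b := #|[pred x | sampled_zero u x && ~~ common_zero x]|.
suff [a ha] : exists a : {ffun 'I_m -> F}, ((z - b)%N%:R : C) <=
    `|\sum_x psi (slice v x + \sum_j a j * slice (u j) x)|.
  exists a; apply: le_trans (ler_wpM2r _ ha); last by rewrite exprn_ge0.
  rewrite -natrX -natrM ler_nat; apply: leq_trans Zr _; rewrite expnS mulnA leq_mul2r.
  apply/orP; right; have := finNzRing_gt1 F; move: half; rewrite -/z -/b => half f1.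
  apply: leq_trans (_ : (z - b) * 2 <= _)%N; last by rewrite leq_mul2l f1 orbT.
  by move: half; clear; lia.
apply: contrapT => /forallNP no.
have lt (a : {ffun 'I_m -> F}) : `|\sum_x psi (slice v x + \sum_j a j * slice (u j) x)| < (z - b)%N%:R :> C.
  by rewrite real_ltNge ?realn ?normr_real //; apply/negP => h; apply: (no a h).
have F0 : (0 : C) < (#|F| ^ m)%:R by rewrite ltr0n expn_gt0 ltnW ?finNzRing_gt1.
have E : \sum_(a : {ffun 'I_m -> F}) \sum_x psi (slice v x + \sum_j a j * slice (u j) x) =
    (#|F| ^ m)%:R * \sum_(x | sampled_zero u x) psi (slice v x).
  rewrite exchange_big big_distrr [RHS]big_mkcond /=; apply: eq_bigr => x _.
  under eq_bigr do rewrite (psiD psiP).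
  rewrite -big_distrr /=.
  rewrite (eq_bigr (fun a : {ffun 'I_m -> F} =>
      psi (\sum_j a j * [ffun j => slice (u j) x] j))) => [|a _]; last first.
    by congr psi; apply: eq_bigr => j _; rewrite ffunE.
  rewrite (sum_psi_dot psiP) card_ord mulrC [sampled_zero _ _](_ : _ =
    ([ffun j => slice (u j) x] == [ffun=> 0])); first by case: eqP; rewrite ?mul0r.
  apply/forallP/eqP => [h|/ffunP h j]; last by have := h j; rewrite !ffunE => ->.
  by apply/ffunP => j; rewrite !ffunE; apply/eqP.
have low : ((z - b)%N%:R : C) <= `|\sum_(x | sampled_zero u x) psi (slice v x)|.
  rewrite (bigID common_zero) /= (eq_bigl common_zero); last first.
    move=> x; case: (boolP (common_zero x)) => [/(common_sampled u) -> //|_].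
    by rewrite andbF.
  rewrite (eq_bigr (fun=> 1)) => [|x /forallP/(_ v)/eqP Tx]; last first.
    by rewrite /slice Tx (psi0 psiP).
  rewrite sumr_const -[#|_|]/z.
  apply: le_trans (lerB_normD _ _).
  have bl : `|\sum_(x | sampled_zero u x && ~~ common_zero x) psi (slice v x)| <= (b%:R : C).
    apply: le_trans (ler_norm_sum _ _ _) _.
    by rewrite (eq_bigr (fun=> 1)) ?sumr_const // => x _; apply: (psi_norm psiP).
  rewrite normr_nat; apply: le_trans (lerB (lexx _) bl).
  by rewrite natrB //; apply: leq_trans half; rewrite leq_pmull.
suff : `|\sum_(a : {ffun 'I_m -> F}) \sum_x psi (slice v x + \sum_j a j * slice (u j) x)|
    < (#|F| ^ m)%:R * (z - b)%N%:R :> C.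
  rewrite E normrM normr_nat ltr_pM2l // => /lt_le_trans/(_ low).
  by rewrite ltxx.
apply: le_lt_trans (ler_norm_sum _ _ _) _.
rewrite -[X in (_ ^ X)%N](card_ord m) -card_ffun mulr_natl -sumr_const.
apply: ltr_sum => [|a _]; last exact: lt.
apply/hasP; exists [ffun=> 0] => //; exact: mem_index_enum.
Qed.

End Slices.

Definition rank_bound k R D := forall J (h : X -> F),
  (0 < #|J| <= k)%N -> multilin J h -> biased psi R h -> prank_le J D h.

Definition regular D (S : finType) (d : S -> {set I}) (f : S -> X -> F) :=
  forall J a, prank_le J D (level_comb d f J a) -> forall j, d j = J -> a j = 0.

(** Among the slots carrying a nonzero coefficient choose a largest set [J]. By
    [bias_top] only the part on [J] matters; by regularity it has large partition
    rank, so it is unbiased. *)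
Lemma regular_unbiased k R D (S : finType) (d : S -> {set I}) f
    (a : {ffun S -> F}) :
  rank_bound k R D -> graded k d f -> regular D d f -> a != [ffun=> 0] ->
  `|\sum_x psi (\sum_j a j * f j x)| * #|F|%:R ^+ R <= #|{: X}|%:R :> C.
Proof.
move=> rb gd reg a0.
have [j1 aj1] : exists j, a j != 0.
  apply/existsP; apply: contraR a0; rewrite negb_exists => /forallP h.
  by apply/eqP/ffunP => j; rewrite ffunE; apply/eqP; have := h j; rewrite negbK.
case: (@arg_maxnP _ j1 (fun j => a j != 0) (fun j => #|d j|) aj1) => j0 aj0 j0max.
set J := d j0; have [J0 Jk _] := gd j0.
pose low j := (a j != 0) && (d j != J).
have top : `|\sum_x psi (\sum_j a j * f j x)| <= `|\sum_x psi (level_comb d f J a x)|.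
  pose d' j := if low j then d j else set0.
  pose g j x := if low j then a j * f j x else 0.
  rewrite (eq_bigr (fun x => psi (level_comb d f J a x + \sum_j g j x))); last first.
    move=> x _; congr psi; rewrite (bigID (fun j => d j == J)) /=; congr (_ + _).
    rewrite big_mkcond; apply: eq_bigr => j _; rewrite /g /low.
    by case: (eqVneq (a j) 0) => [->|_] /=; case: ifP; rewrite ?mul0r.
  apply: (bias_top psiP (J := J) (d := d')).
  - apply: multilin_sum => j /eqP dj; apply: multilin_scale; rewrite -dj.
    by have [_ _] := gd j.
  - move=> j; rewrite /d' /g; case: ifP => _; last exact: multilin0.
    by apply: multilin_scale; have [_ _] := gd j.
  move=> j; rewrite /d'; case: ifP => [/andP[aj dj]|_]; last by rewrite subset0.
  apply: contra dj => sub; rewrite eq_sym eqEcard sub /=; exact: j0max.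
apply: le_trans (ler_wpM2r _ top) _; first by rewrite exprn_ge0.
apply: contrapT => /negP; rewrite -real_ltNge ?realn //; last first.
  by rewrite realM ?normr_real // -natrX realn.
move=> /ltW bi; case/eqP: aj0; apply: (reg J) => //.
apply: rb => //; first by rewrite card_gt0 J0.
by apply: multilin_sum => j /eqP dj; apply: multilin_scale; rewrite -dj; have [_ _] := gd j.
Qed.

(** Pigeonhole over the atoms that make up [Y]. *)
Lemma dense_atom (A : finType) (f : A -> X -> F) (Y Z : pred X) t x0 :
  (forall x y, val_at f x = val_at f y -> Y x -> Y y) -> Y x0 ->
  (t * #|[pred x | Y x && ~~ Z x]| <= #|[pred x | Y x]|)%N ->
  exists c : A -> F,
   (t * #|[pred x | [forall a, f a x == c a] && ~~ Z x]|
     <= #|[pred x | [forall a, f a x == c a]]|)%N.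
Proof.
move=> Yf Yx0 dense.
pose W (c : {ffun A -> F}) := [exists x, (val_at f x == c) && Y x].
have atomE (c : {ffun A -> F}) x : [forall a, f a x == c a] = (val_at f x == c).
  apply/forallP/eqP => [h|<- a]; last by rewrite ffunE.
  by apply/ffunP => a; rewrite ffunE; apply/eqP.
have WY c x : W c -> val_at f x = c -> Y x.
  by case/existsP=> y /andP[/eqP <-] Yy e; apply: Yf Yy.
have fib (Q : pred X) : (forall x, Q x -> Y x) ->
    (#|[pred x | Q x]| = \sum_(c | W c) #|[pred x | (val_at f x == c) && Q x]|)%N.
  move=> QY; rewrite -sum1_card (partition_big (val_at f) W) /=; last first.
    by move=> x Qx; apply/existsP; exists x; rewrite eqxx QY.
  apply: eq_bigr => c _; rewrite -sum1_card; apply: eq_bigl => x /=.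
  by rewrite !inE andbC.
apply: contrapT => no; move: dense; apply/negP; rewrite -ltnNge.
rewrite (fib (fun x => Y x && ~~ Z x)) => [|x /andP[]//]; rewrite (fib Y) // big_distrr /=.
have lt c : W c -> (#|[pred x | (val_at f x == c) && Y x]| <
    t * #|[pred x | (val_at f x == c) && (Y x && ~~ Z x)]|)%N.
  move=> Wc; rewrite ltnNge; apply/negP => le; apply: no; exists c.
  move: le; congr (_ * _ <= _)%N; apply: eq_card => x; rewrite !inE atomE;
  by case: eqP => // /(WY _ _ Wc) ->.
have W0 : W (val_at f x0) by apply/existsP; exists x0; rewrite eqxx.
rewrite (bigD1 _ W0) [X in (_ < X)%N](bigD1 _ W0) /= -addSn.
by apply: leq_add; [exact: lt | apply: leq_sum => c /andP[/lt/ltnW]].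
Qed.

End Step.

(** * Bias implies bounded partition rank *)

Definition uniform_rank_bound (I : finType) k r D :=
  forall (F : finFieldType) (C : numClosedFieldType) (psi : F -> C) n,
  addchar psi -> @rank_bound F n I C psi k r D.

Lemma biased_linear (F : finFieldType) (C : numClosedFieldType) (psi : F -> C) n
    (I : finType) (i : I) r (T : {ffun I -> 'rV[F]_n} -> F) :
  addchar psi -> multilin [set i] T -> biased psi r T -> forall x, T x = 0.
Proof.
move=> psiP lT bT x.
have := card_common_zero psiP (set11 i) lT bT.
have X0 : (0 < #|{: {ffun I -> 'rV[F]_n}}|)%N by apply/card_gt0P; exists x.
case: (posnP #|[pred y | common_zero i T y]|) => [->|/card_gt0P[y]].
  by rewrite mul0n leqNgt X0.
rewrite inE => /forallP/(_ (x i))/eqP <- _; apply: (multilin_local lT) => j.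
by rewrite inE => /eqP ->; rewrite updE eqxx.
Qed.

Section MainStep.
Variables (I : finType) (k : nat).
Variables (Dk : nat -> nat).
Hypothesis DkP : forall r, uniform_rank_bound I k r (Dk r).

(** The inductive step. The size of the family [A] is bounded first ([N1]); the bound
    [N2] on the relative regularization then depends on it, so [A] has to be regular
    enough ([rho1]) for every size that the second family can have. *)
Lemma prank_step r : (0 < k)%N -> exists D,
  forall (F : finFieldType) (C : numClosedFieldType) (psi : F -> C) n (J : {set I}) (i : I)
    (T : {ffun I -> 'rV[F]_n} -> F),
  addchar psi -> i \in J -> #|J| = k.+1 -> multilin J T -> biased psi r T -> prank_le J D T.
Proof.
move=> k0.
pose D1 := Dk r.+1.
have [N2 N2P] : exists N2 : nat -> nat, forall M : nat, forall (F : finFieldType) n (A : finType) (dA : A -> {set I})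
    (fA : A -> {ffun I -> 'rV[F]_n} -> F) (L : finType) (dL : L -> {set I}) fL,
  graded k dL fL -> (#|L| <= D1 + D1)%N ->
  exists (L' : finType) (dL' : L' -> {set I}) fL', [/\ graded k dL' fL',
    (#|L'| <= N2 M)%N, rel_regular (Dk (M + #|L'|).+2) dA fA dL' fL' &
    forall l, generated (joinf dA dL') (joinf fA fL') (dL l) (fL l)].
  have /choice[N2 N2P] : forall M, exists N, _ :=
    fun M => @regularize I k (fun N' => Dk (M + N').+2) (D1 + D1)%N.
  by exists N2.
pose rho1 M := (\max_(N' < (N2 M).+1) Dk (M + N').+2)%N.
(* [#|F| ^- m] is at most [2 ^- k.+1] times the density of the common zeros. *)
pose m := (r + k.+1)%N.
have [N1 N1P] := @regularize I k rho1 m.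
exists N1 => F C psi n J i T psiP iJ Jk lT bT.
set K := J :\ i.
have Kk : #|K| = k by move: Jk; rewrite (cardsD1 i) iJ => -[].
have K0 : K != set0 by rewrite -card_gt0 Kk.
have F1 := finNzRing_gt1 F.
have lS := multilin_slice i lT.
have [u smallu] := sampling iJ lT m.
have Zr := card_common_zero psiP iJ lT bT.
pose Z := [pred x | common_zero i T x]; pose Y := [pred x | sampled_zero i T u x].
have YZ : (2 ^ k.+1 * #|[pred x | Y x && ~~ Z x]| <= #|[pred x | Z x]|)%N.
  have q0 : (0 < #|F| ^ r)%N by rewrite expn_gt0 ltnW.
  rewrite -(leq_pmul2r q0); apply: leq_trans Zr; apply: leq_trans smallu.
  rewrite mulnAC mulnC leq_mul2l; apply/orP; right.
  by rewrite expnD mulnC leq_mul2l leq_exp2r // F1 orbT.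
have ZY : (#|[pred x | Z x]| <= #|[pred x | Y x]|)%N.
  by apply/subset_leq_card/subsetP => x; apply: common_sampled.
have [||A [dA [fA [gA cA rA eA]]]] := N1P F n void (fun=> set0) (fun _ _ => 0)
   'I_m (fun=> K) (fun j => slice i T (u j)).
- by move=> j; split; rewrite ?Kk.
- by rewrite card_ord.
have genA j : generated dA fA K (slice i T (u j)).
  by apply: gen_trans (eA j) => -[[]|a]; apply: gen_base.
have regA : regular (rho1 #|A|) dA fA.
  move=> J' a pk j; apply: (rA J' (fun=> 0)).
  by apply: eq_prank_le pk => x; rewrite [level_comb (fun=> set0) _ _ _ _]big1 ?add0r // => -[].
have dA0 a : dA a != set0 by have [] := gA a.
have lA a : multilin (dA a) (fA a) by have [_ _] := gA a.
have Yval x y : val_at fA x = val_at fA y -> Y x -> Y y.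
  move=> e /forallP Yx; apply/forallP => j; move: (Yx j).
  by have [q [_ eq]] := gen_expr dA0 (genA j); rewrite !eq e.
have Y0 : Y [ffun=> 0].
  apply/forallP => j; have [i' iK] := set0Pn _ K0.
  rewrite -(upd_id [ffun=> 0] i') ffunE.
  by rewrite (lin_at0 _ ((lS (u j)).1 _ iK)).
have [c cZ] := dense_atom Yval Y0 (leq_trans YZ ZY).
(* Every slice is in the ideal generated by [A]. *)
have slice_ideal v : exists G : A -> {ffun I -> 'rV[F]_n} -> F,
    (forall a, multilin (K :\: dA a) (G a)) /\
    forall x, slice i T v x = \sum_(a | dA a \subset K) fA a x * G a x.
  have half : (2 * #|[pred x | sampled_zero i T u x && ~~ common_zero i T x]|
     <= #|[pred x | common_zero i T x]|)%N.
    apply: leq_trans YZ; rewrite leq_mul2r; apply/orP; right.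
    by rewrite expnS leq_pmulr // expn_gt0.
  have [a ba] := slice_biased psiP iJ lT v bT half.
  have lr : multilin K (fun x => slice i T v x + \sum_j a j * slice i T (u j) x).
    by apply: multilinD => //; apply: multilin_sum => j _; apply: multilin_scale.
  have [|S [d [f [g [cS dS fgS eS]]]]] := DkP psiP _ lr ba; first by rewrite Kk k0 leqnn.
  have gS : graded k (joinf d (fun s => K :\: d s)) (joinf f g).
    case=> s /=; have [d0 dK] := dS s; have [fs gs] := fgS s; split=> //.
    - by rewrite -Kk subset_leq_card // proper_sub.
    - by rewrite setD_eq0; move: dK; rewrite properE => /andP[].
    - by rewrite -Kk subset_leq_card // subsetDl.
  have cSS : (#|{: S + S}| <= D1 + D1)%N by rewrite card_sum leq_add.
  have [B [dB [fB [gB cB rB eB]]]] := N2P #|A| F n A dA fA _ _ _ gS cSS.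
  have gAB : graded k (joinf dA dB) (joinf fA fB) by case.
  have regAB : regular (Dk (#|A| + #|B|).+2) (joinf dA dB) (joinf fA fB).
    move=> J' e pk.
    have pk' : prank_le J' (Dk (#|A| + #|B|).+2)
        (fun x => level_comb dA fA J' (fun a => e (inl a)) x + level_comb dB fB J' (fun b => e (inr b)) x).
      by apply: eq_prank_le pk => x; rewrite /level_comb big_sumType.
    have eB0 := rB _ _ _ pk'.
    case=> [a'|b'] /= dj; last exact: eB0.
    apply: (regA J' (fun a => e (inl a))) dj.
    apply: (@prank_le_leq _ _ _ _ (Dk (#|A| + #|B|).+2)).
      exact: (@leq_bigmax 'I_(N2 #|A|).+1 (fun i => Dk (#|A| + i).+2)
        (Ordinal (cB : #|B| < (N2 #|A|).+1)%N)).
    apply: eq_prank_le pk' => x; rewrite [level_comb dB _ _ _ _]big1 ?addr0 // => b /eqP/eB0 ->.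
    by rewrite mul0r.
  have dAB0 s : joinf dA dB s != set0 by have [] := gAB s.
  have equi := equidistributed psiP (f := joinf fA fB) _.
  have {}equi : forall y, (3 * #|{: {ffun I -> 'rV[F]_n}}| <= 4 * #|F| ^ #|{: A + B}| *
     #|[pred x | val_at (joinf fA fB) x == y]| <= 5 * #|{: {ffun I -> 'rV[F]_n}}|)%N.
    apply: equi => e e0; rewrite card_sum.
    exact: (regular_unbiased psiP (@DkP _ _ _ _ n psiP) gAB regAB e0).
  have genAB : generated (joinf dA dB) (joinf fA fB) K (slice i T v).
    have eA' a' : generated (joinf dA dB) (joinf fA fB) (dA a') (fA a').
      exact: (gen_base _ (joinf fA fB) (inl a')).
    have g1 : generated (joinf dA dB) (joinf fA fB) K (fun x => \sum_j a j * slice i T (u j) x).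
      by apply: gen_sum => j _; apply: gen_trans (genA j).
    have g2 : generated (joinf dA dB) (joinf fA fB) K (fun x => \sum_s 1 * (f s x * g s x)).
      apply: gen_sum => s _.
      have -> : K = d s :|: (K :\: d s).
        by rewrite -{1}(setID K (d s)) (setIidPr (proper_sub (dS s).2)).
      apply: gen_mul (eB (inl s)) (eB (inr s)).
      by rewrite -setI_eq0 setIDA setDIl setDv set0I.
    apply: gen_ext (gen_lin (-1) g1 g2) => x /=.
    have -> : \sum_s 1 * (f s x * g s x) = \sum_s f s x * g s x.
      by apply: eq_bigr => s _; rewrite mul1r.
    by rewrite -eS mulN1r addrC addrK.
  have [q [qt qE]] := gen_expr dAB0 genAB.
  have qA := atom_ideal dAB0 (c := c) _ qt equi _.
  apply: (ideal_split lA _ qt _ qE); first by move=> b; have [_ _] := gB b.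
  apply: qA (eq_leq Kk) _.
  apply: leq_trans cZ; rewrite leq_mul2l; apply/orP; right.
  apply/subset_leq_card/subsetP => x; rewrite !inE => /andP[-> /=]; apply: contra.
  by move=> /forallP/(_ v); rewrite -qE.
(* Slices are linear in [v], so those at the unit vectors determine [T]. *)
have [G GP] := choice slice_ideal.
pose P := [pred a | dA a \subset K]; pose e (s : 'I_#|P|) := enum_val s.
have eP s : dA (e s) \subset K := enum_valP s.
exists 'I_#|P|, (fun s => dA (e s)), (fun s => fA (e s)),
  (fun s (x : {ffun I -> 'rV[F]_n}) => \sum_j x i 0 j * G (delta_mx 0 j) (e s) x); split.
- by rewrite card_ord (leq_trans (max_card _)).
- by move=> s; split; [exact: dA0 | exact: sub_proper_trans (eP s) (properD1 iJ)].
- move=> s; split; first exact: lA.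
  have -> : J :\: dA (e s) = [set i] :|: (K :\: dA (e s)).
    apply/setP => j; rewrite !inE; case: (eqVneq j i) => [->|//].
    by rewrite iJ andbT; apply/negP => /(subsetP (eP s)); rewrite !inE eqxx.
  apply: multilin_sum => j _; apply: multilinM; last by case: (GP (delta_mx 0 j)).
    by rewrite disjoints1 !inE eqxx /= andbF.
  split=> j'; rewrite inE; last by move=> ij' x v; rewrite updE eq_sym (negPf ij').
  by move=> /eqP -> x b v w; rewrite !updE eqxx !mxE.
move=> x.
have -> : T x = \sum_j x i 0 j * slice i T (delta_mx 0 j) x.
  rewrite -{1}(upd_id x i) -[T _]/(slice i T (x i) x) {1}(row_sum_delta (x i)).
  apply: (big_rec2 (fun v t => slice i T v x = t)) => [|j t v _ <-].
    by apply: (lin_at0 x (lT.1 i iJ)).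
  exact: (slice_lin iJ lT).
under eq_bigr do rewrite (GP _).2 big_distrr /=.
rewrite exchange_big /= (big_enum_val (A := P)); apply: eq_bigr => s _.
by rewrite big_distrr; apply: eq_bigr => j _; rewrite mulrCA.
Qed.
End MainStep.

Theorem uniform_rank_bound_exists (I : finType) k r : exists D, uniform_rank_bound I k r D.
Proof.
elim: k r => [|k IH] r.
  exists 0%N => F C psi n psiP J T; lia.
have /choice[Dk DkP] := IH.
have [D DP] : exists D, forall (F : finFieldType) (C : numClosedFieldType) (psi : F -> C) n
    (J : {set I}) (i : I) (T : {ffun I -> 'rV[F]_n} -> F), addchar psi ->
    i \in J -> #|J| = k.+1 -> multilin J T -> biased psi r T -> prank_le J D T.
  have [k0|] := posnP k; last exact: prank_step.
  exists 0%N => F C psi n J i T psiP iJ Jk lT bT.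
  have Ji : J = [set i].
    by apply/esym/eqP; rewrite eqEcard sub1set iJ cards1 Jk k0.
  exists void, (fun=> set0), (fun _ _ => 0), (fun _ _ => 0); split=> //.
  - by rewrite card_void.
  move=> x; rewrite big1 => [|[]]; rewrite Ji in lT.
  exact: (biased_linear psiP lT bT).
exists (maxn (Dk r) D) => F C psi n psiP J T /andP[J0 Jk] lT bT.
move: Jk; rewrite leq_eqVlt ltnS => /orP[/eqP Jk|Jk].
  have /card_gt0P[i iJ] := J0; apply: (prank_le_leq (leq_maxr _ _)).
  exact: DP psiP iJ Jk lT bT.
by apply: (prank_le_leq (leq_maxl _ _)); apply: (DkP r) psiP _ _ _ _ bT; rewrite ?J0.
Qed.

(** * Discrete derivatives and degree *)

Section Derivatives.
Variables (V : zmodType) (F : comPzRingType).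
Implicit Types (f g : V -> F) (h x : V) (s : seq V).

Definition delta h f x := f (x + h) - f x.

Definition der s f := foldl (fun g h => delta h g) f s.

(** Degree less than [d], for functions: all iterated derivatives of order [d]
    vanish. *)
Fixpoint deg_lt d f : Prop :=
  if d is d'.+1 then forall h, deg_lt d' (delta h f) else f = (fun=> 0).

Lemma deltaC h k f : delta h (delta k f) = delta k (delta h f).
Proof. by apply/funext => x; rewrite /delta [x + k + h]addrAC; ring. Qed.

Lemma delta_der h s f : delta h (der s f) = der s (delta h f).
Proof. by elim: s f => //= k s IH f; rewrite IH deltaC. Qed.

Lemma der_rcons s h f : der (rcons s h) f = delta h (der s f).
Proof. by rewrite /der -cats1 foldl_cat. Qed.

Lemma der_cat s t f : der (s ++ t) f = der t (der s f).
Proof. by rewrite /der foldl_cat. Qed.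

Lemma deg_ltP d f : deg_lt d f <-> forall s, size s = d -> der s f = (fun=> 0).
Proof.
elim: d f => [|d IH] f /=.
  by split=> [-> [] | /(_ [::] erefl)].
split=> [fd [//|h s] [sd] | fd h]; first by apply: (IH (delta h f)).1.
by apply/IH => s sd; apply: (fd (h :: s)); rewrite /= sd.
Qed.

Lemma deg_ltS d f : deg_lt d f -> deg_lt d.+1 f.
Proof.
elim: d f => [|d IH] f /=; last by move=> fd h; apply: IH.
by move=> -> h; apply/funext => x; rewrite /delta subrr.
Qed.

Lemma deg_lt_leq d e f : (d <= e)%N -> deg_lt d f -> deg_lt e f.
Proof.
move=> /subnK <-; elim: (e - d)%N => // k IH fd; rewrite addSn.
by apply: deg_ltS; apply: IH.
Qed.

Lemma delta0 h : delta h (fun=> 0) = (fun=> 0).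
Proof. by apply/funext => x; rewrite /delta subrr. Qed.

Lemma deg_lt0 d : deg_lt d (fun=> 0).
Proof. by elim: d => //= d IH h; rewrite delta0. Qed.

Lemma deg_ltD d f g : deg_lt d f -> deg_lt d g -> deg_lt d (fun x => f x + g x).
Proof.
elim: d f g => [|d IH] f g /=; first by move=> -> ->; apply/funext => x; rewrite addr0.
move=> fd gd h; have -> : delta h (fun x => f x + g x) =
    (fun x => delta h f x + delta h g x) by apply/funext => x; rewrite /delta; ring.
exact: IH.
Qed.

Lemma deg_lt_const c : deg_lt 1 (fun=> c).
Proof. by move=> h; apply/funext => x; rewrite /delta subrr. Qed.

(** Leibniz rule [D (f g) = D f g + f D g + D f D g], by induction on [a + b]. *)
Lemma deg_ltM a b f g : deg_lt a.+1 f -> deg_lt b.+1 g -> deg_lt (a + b).+1 (fun x => f x * g x).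
Proof.
move eN : (a + b)%N => N; elim: N a b eN f g => [|N IH] a b eN f g fa gb h.
  have [a0 b0] : a = 0%N /\ b = 0%N by lia.
  move: fa gb; rewrite a0 b0 => /(_ h)/funeqP fc /(_ h)/funeqP gc.
  apply/funext => x; have := fc x; have := gc x; rewrite /delta => /subr0_eq -> /subr0_eq ->.
  by rewrite subrr.
have E : delta h (fun x => f x * g x) = (fun x => (delta h f x * g x + f x * delta h g x)
    + delta h f x * delta h g x) by apply/funext => x; rewrite /delta; ring.
change (deg_lt N.+1 (delta h (fun x => f x * g x))).
have fh := fa h; have gh := gb h; rewrite E.
case: a b eN fa gb fh gh => [|a] [|b] // eN fa gb fh gh.
- have -> : delta h f = (fun=> 0) by exact: fh.
  apply: deg_ltD; first apply: deg_ltD.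
  + by have -> : (fun x => 0 * g x) = (fun=> 0); [apply/funext => x; rewrite mul0r | exact: deg_lt0].
  + by apply: (IH 0%N b) => //; lia.
  + by have -> : (fun x => 0 * delta h g x) = (fun=> 0); [apply/funext => x; rewrite mul0r | exact: deg_lt0].
- have -> : delta h g = (fun=> 0) by exact: gh.
  apply: deg_ltD; first apply: deg_ltD.
  + by apply: (IH a 0%N) => //; lia.
  + by have -> : (fun x => f x * 0) = (fun=> 0); [apply/funext => x; rewrite mulr0 | exact: deg_lt0].
  + by have -> : (fun x => delta h f x * 0) = (fun=> 0); [apply/funext => x; rewrite mulr0 | exact: deg_lt0].
apply: deg_ltD; first apply: deg_ltD.
- by apply: (IH a b.+1) => //; lia.
- by apply: (IH a.+1 b) => //; lia.
by apply: (IH a b.+1) => //; [lia | apply: deg_ltS].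
Qed.

Lemma deg_lt_prod (S : Type) (l : seq S) (e : S -> nat) (f : S -> V -> F) :
  (forall t, deg_lt (e t).+1 (f t)) ->
  deg_lt (\sum_(t <- l) e t).+1 (fun x => \prod_(t <- l) f t x).
Proof.
move=> fe; elim: l => [|t l IH].
  rewrite big_nil; have -> : (fun x => \prod_(t <- [::]) f t x) = (fun=> 1).
    by apply/funext => x; rewrite big_nil.
  exact: deg_lt_const.
rewrite big_cons; have -> : (fun x => \prod_(s0 <- t :: l) f s0 x) =
    (fun x => f t x * \prod_(s0 <- l) f s0 x) by apply/funext => x; rewrite big_cons.
exact: deg_ltM.
Qed.

Lemma deg_ltX k a f : deg_lt a.+1 f -> deg_lt (a * k).+1 (fun x => f x ^+ k).
Proof.
move=> fa; elim: k => [|k IH]; first by rewrite muln0; apply: deg_lt_const.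
rewrite mulnS; have -> : (fun x => f x ^+ k.+1) = (fun x => f x * f x ^+ k).
  by apply/funext => x; rewrite exprS.
exact: deg_ltM.
Qed.

Lemma deg_lt_sum d (S : eqType) (l : seq S) (f : S -> V -> F) :
  {in l, forall t, deg_lt d (f t)} -> deg_lt d (fun x => \sum_(t <- l) f t x).
Proof.
elim: l => [|t l IH] fd.
  have -> : (fun x => \sum_(t <- [::]) f t x) = (fun=> 0).
    by apply/funext => x; rewrite big_nil.
  exact: deg_lt0.
have -> : (fun x => \sum_(s <- t :: l) f s x) =
    (fun x => f t x + \sum_(s <- l) f s x) by apply/funext => x; rewrite big_cons.
apply: deg_ltD; first by apply: fd; rewrite mem_head.
by apply: IH => s sl; apply: fd; rewrite inE sl orbT.
Qed.

Lemma deg_lt_additive f : {morph f : x y / x + y} -> deg_lt 2 f.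
Proof.
by move=> fD h k; apply/funext => x; rewrite /delta !fD; ring.
Qed.

Lemma bump0S i : bump 0 i = i.+1.
Proof. by []. Qed.

Lemma der_nseq m h g x :
  der (nseq m h) g x =
  \sum_(j < m.+1) (-1) ^+ (m - j) * 'C(m, j)%:R * g (x + h *+ j).
Proof.
elim: m x => [|m IH] x.
  by rewrite big_ord_recl big_ord0 /= expr0 bin0 !mul1r addr0 mulr0n addr0.
rewrite -[m.+1]addn1 nseqD der_cat /= /delta !IH addn1.
rewrite big_ord_recr /= subnn binn expr0 !mul1r.
rewrite [in RHS]big_ord_recl /= subn0 bin0 mulr0n addr0 mulr1.
rewrite [in RHS]big_ord_recr /=.
rewrite [X in _ - X]big_ord_recl /= subn0 bin0 mulr0n addr0 mulr1.
rewrite !bump0S subnn expr0 binn !mul1r.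
have shift j : x + h + h *+ j = x + h *+ j.+1 by rewrite -addrA -mulrS.
rewrite shift exprS mulN1r mulNr.
suff E : \sum_(i < m) (-1) ^+ (m.+1 - bump 0 i) * 'C(m.+1, bump 0 i)%:R *
      g (x + h *+ bump 0 i) =
    \sum_(i < m) (-1) ^+ (m - i) * 'C(m, i)%:R * g (x + h + h *+ i) -
    \sum_(i < m) (-1) ^+ (m - bump 0 i) * 'C(m, bump 0 i)%:R * g (x + h *+ bump 0 i).
  by rewrite E; ring.
rewrite -sumrB; apply: eq_bigr => i _; rewrite shift !bump0S subSS binS natrD.
have -> : (m - i)%N = (m - i.+1).+1 by rewrite subnSK.
by rewrite exprS; ring.
Qed.

End Derivatives.

(** * Common zeros of low degree functions *)

Section PrimeField.
Variable p : nat.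
Hypothesis p_pr : prime p.
Notation F := 'F_p.

Lemma Fp_scale_additive (V : lmodType F) (f : V -> F) a u :
  {morph f : x y / x + y} -> f (a *: u) = a * f u.
Proof.
move=> fD; have f0 : f 0 = 0.
  by apply: (addrI (f 0)); rewrite -fD !addr0.
have fM k : f (u *+ k) = f u *+ k.
  by elim: k => [|k IH]; rewrite ?mulr0n // !mulrS fD IH.
by rewrite -[a]natr_Zp scaler_nat fM mulr_natl.
Qed.

Lemma Fp_natp : p%:R = 0 :> F.
Proof. by have /andP[_ /eqP] := pchar_Fp p_pr. Qed.

(** The coefficients of [(X - 1) ^ (p - 1) = 1 + X + .. + X ^ (p - 1)] modulo [p]. *)
Lemma Fp_bin_pred j : (j < p)%N -> ((-1) ^+ (p.-1 - j) * 'C(p.-1, j)%:R = 1 :> F).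
Proof.
have p0 := prime_gt0 p_pr.
have step i : (i.+1 < p)%N -> ('C(p.-1, i.+1)%:R = - 'C(p.-1, i)%:R :> F).
  move=> ip; apply/eqP; rewrite -addr_eq0 -natrD -binS prednK //.
  have /dvdnP[k ->] := @prime_dvd_bin i.+1 p p_pr ip.
  by rewrite natrM Fp_natp mulr0.
move=> jp; have -> : (-1) ^+ (p.-1 - j) = (-1) ^+ p.-1 * (-1) ^+ j :> F.
  have {2}-> : p.-1 = (p.-1 - j + j)%N by rewrite subnK // -ltnS prednK.
  by rewrite exprD -mulrA -exprD addnn -mul2n exprM sqrrN expr1n expr1n mulr1.
have -> : 'C(p.-1, j)%:R = (-1) ^+ j :> F.
  elim: j jp => [|j IH] jp; first by rewrite bin0.
  by rewrite step // IH ?(ltnW jp) // exprS mulN1r.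
rewrite -mulrA -exprD addnn -mul2n exprM sqrrN expr1n expr1n mulr1.
have [p2|p_odd] := even_prime p_pr; last first.
  by rewrite -signr_odd; move: p_odd; rewrite -{1}(prednK p0) /= => /negPf ->.
have -> : p.-1 = 1%N by rewrite p2.
rewrite expr1; apply/eqP; rewrite eq_sym -addr_eq0.
suff -> : 1 + 1 = p%:R :> F by rewrite Fp_natp.
by rewrite -(natrD _ 1 1); congr (_ %:R); rewrite p2.
Qed.

Lemma der_nseq_pred (V : lmodType F) (g : V -> F) h x :
  der (nseq p.-1 h) g x = \sum_(t : F) g (x + t *: h).
Proof.
have p0 := prime_gt0 p_pr.
rewrite der_nseq prednK // (eq_bigr (fun j : 'I_p => g (x + h *+ j))); last first.
  by move=> j _; rewrite Fp_bin_pred // mul1r.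
have cF := card_Fp p_pr.
rewrite [RHS](reindex (fun j : 'I_p => (j%:R : F))) /=.
  by apply: eq_bigr => j _; rewrite scaler_nat.
exists (fun t : F => insubd (Ordinal p0) (t : nat)) => [j|t] _.
  apply: val_inj; rewrite val_insubd /= val_Fp_nat // modn_small //.
  by rewrite ltn_ord.
rewrite val_insubd.
have tp : (t < p)%N by rewrite -[X in (_ < X)%N](Fp_cast p_pr).
by rewrite tp natr_Zp.
Qed.

(** Summing along a line is a derivative of order [p - 1] ([der_nseq_pred]), so summing
    over the whole space is one of order [N * (p - 1)]. *)
Lemma sum_deg_lt_eq0 N (g : 'rV[F]_N -> F) : deg_lt (N * p.-1) g -> \sum_x g x = 0.
Proof.
move=> gd.
pose e (i : 'I_N) : 'rV[F]_N := delta_mx 0 i.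
pose dirs (l : seq 'I_N) := flatten [seq nseq p.-1 (e i) | i <- l].
have key (l : seq 'I_N) : uniq l -> forall x, der (dirs l) g x =
    \sum_(y : 'rV[F]_N | [forall i, (i \notin l) ==> (y 0 i == 0)]) g (x + y).
  elim/last_ind: l => [_ x|l i IH].
    rewrite (big_pred1 0) ?addr0 // => y; apply/forallP/eqP => [h|-> i].
      by apply/rowP => i; rewrite mxE; apply/eqP; have := h i.
    by rewrite mxE eqxx.
  rewrite rcons_uniq => /andP[il ul] x.
  rewrite /dirs map_rcons flatten_rcons der_cat der_nseq_pred.
  under eq_bigr do rewrite IH //.
  rewrite [RHS](partition_big (fun y : 'rV[F]_N => y 0 i) xpredT) //=.
  apply: eq_bigr => t _.
  rewrite [RHS](reindex_inj (addrI (t *: e i))) /=.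
  apply: eq_big => [y|y _]; last by rewrite addrA.
  rewrite !mxE !eqxx mulr1.
  have -> : (t + y 0 i == t) = (y 0 i == 0).
    by rewrite -[X in _ == X]addr0 (inj_eq (addrI t)).
  apply/forallP/andP => [h|[/forallP h yi] j].
    split; last by have := h i; rewrite il.
    apply/forallP => j; rewrite mem_rcons inE negb_or; apply/implyP => /andP[ji jl].
    by rewrite !mxE eqxx (negPf ji) mulr0 add0r; have := h j; rewrite jl.
  apply/implyP => jl; have [-> //|ji] := eqVneq j i.
  by have := h j; rewrite mem_rcons inE negb_or ji jl !mxE eqxx (negPf ji) mulr0 add0r.
have := key (enum 'I_N) (enum_uniq _) 0.
rewrite (eq_bigl xpredT) => [|y]; last first.
  by apply/forallP => i; rewrite mem_enum.
under eq_bigr do rewrite add0r.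
move=> <-; rewrite (_ : der _ _ = (fun=> 0)) //; apply: (deg_ltP _ _).1 gd _ _.
rewrite /dirs size_flatten /shape -map_comp (eq_map (g := fun=> p.-1)).
  by rewrite sumnE big_map big_enum sum_nat_const card_ord.
by move=> i /=; rewrite size_nseq.
Qed.

(** Chevalley-Warning: the indicator function of the common zeros has degree at most
    [2 (p - 1) #|S|], so its sum vanishes modulo [p] and 0 cannot be the only common
    zero. *)
Lemma common_root N (S : finType) (Q : S -> 'rV[F]_N -> F) :
  (2 * #|S| < N)%N -> (forall s, deg_lt 3 (Q s)) -> (forall s, Q s 0 = 0) ->
  exists2 v, v != 0 & forall s, Q s v = 0.
Proof.
move=> SN Qd Q0; apply: contrapT => no.
have p1 : (0 < p.-1)%N by rewrite -ltnS prednK ?prime_gt1 ?prime_gt0.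
pose g (x : 'rV[F]_N) : F := \prod_(s : S) (1 + -1 * Q s x ^+ p.-1).
have gE x : g x = (x == 0)%:R.
  case: eqP => [->|/eqP x0].
    by rewrite /g big1 // => s _; rewrite Q0 expr0n eqn0Ngt p1 mulr0 addr0.
  have [s Qs] : exists s, Q s x != 0.
    apply/existsP; apply: contra_notT no; rewrite negb_exists => /forallP h.
    by exists x => // s; apply/eqP; have := h s; rewrite negbK.
  rewrite /g (bigD1 s) //= (_ : Q s x ^+ p.-1 = 1) ?mulr1 ?subrr ?mul0r //.
  apply: (mulfI Qs); rewrite -exprS prednK ?prime_gt0 // mulr1.
  by rewrite -[X in _ ^+ X = _](card_Fp p_pr) expf_card.
have : \sum_x g x = 0.
  apply: sum_deg_lt_eq0; apply: (@deg_lt_leq _ _ (\sum_(s : S) 2 * p.-1).+1).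
    by rewrite sum_nat_const mulnA mulnC [(#|S| * 2)%N]mulnC [(p.-1 * _)%N]mulnC ltn_pmul2r.
  apply: (@deg_lt_prod _ _ _ _ (fun=> 2 * p.-1)%N) => s.
  apply: deg_ltD; first by apply: (@deg_lt_leq _ _ 1%N) => //; apply: deg_lt_const.
  apply: (@deg_ltM _ _ 0); first exact: deg_lt_const.
  exact: (@deg_ltX _ _ p.-1 2 (Q s)).
rewrite (bigD1 0) //= gE eqxx big1 => [/eqP|x /negPf x0]; last by rewrite gE x0.
by rewrite addr0 oner_eq0.
Qed.

End PrimeField.

(** * Subspaces killing linear and bilinear forms *)

Section Forms.
Variables (F : finFieldType) (n : nat) (I : finType).
Notation V := 'rV[F]_n.
Notation X := {ffun I -> V}.

Definition linear_form (l : V -> F) := forall a u v, l (a *: u + v) = a * l u + l v.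

Definition bilinear_form (b : V -> V -> F) :=
  (forall w, linear_form (b^~ w)) /\ (forall v, linear_form (b v)).

Lemma linear_form0 l : linear_form l -> l 0 = 0.
Proof. by move=> ll; have := ll (-1) 0 0; rewrite scaler0 addr0 mulN1r addNr. Qed.

Lemma linear_form_sum l m (y : 'rV[F]_m) (M : 'M[F]_(m, n)) :
  linear_form l -> l (y *m M) = \sum_i y 0 i * l (row i M).
Proof.
move=> ll; rewrite mulmx_sum_row.
apply: (big_rec2 (fun v t => l v = t)) => [|i v t _ <-]; first exact: linear_form0.
exact: ll.
Qed.

(** A form in one or two slots, seen as a pair of a linear and a bilinear form one of
    which is 0. *)
Lemma low_order_form (J : {set I}) (h : X -> F) : multilin J h -> (0 < #|J| <= 2)%N ->
  exists (l : V -> F) (b : V -> V -> F), [/\ linear_form l, bilinear_form b &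
    forall x : X, (forall i, l (x i) = 0) -> (forall i j, b (x i) (x j) = 0) -> h x = 0].
Proof.
move=> hJ /andP[J0 J2]; have /card_gt0P[i iJ] := J0.
have lin0 : linear_form (fun=> 0) by move=> a u v; rewrite mulr0 addr0.
have [Ji|] := eqVneq (J :\ i) set0.
  have {}Ji : J = [set i] by rewrite -(setD1K iJ) Ji setU0.
  exists (fun v => h (upd [ffun=> 0] i v)), (fun _ _ => 0); split=> // [a u v|x lx _].
    exact: hJ.1.
  rewrite -(lx i); apply: (multilin_local hJ) => j; rewrite Ji inE => /eqP ->.
  by rewrite updE eqxx.
case/set0Pn=> j; rewrite inE => /andP[]; rewrite inE => ji jJ.
have {}Jij : J = [set i; j].
  apply/esym/eqP; rewrite eqEcard cards2 eq_sym ji J2 andbT.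
  by apply/subsetP => t; rewrite !inE => /orP[] /eqP ->.
exists (fun=> 0), (fun v w => h (upd (upd [ffun=> 0] i v) j w)); split=> //.
  split=> [w a u v|v a u w]; last exact: hJ.1.
  by rewrite !(@updC _ _ _ i j) 1?eq_sym //; apply: hJ.1.
move=> x _ bx; rewrite -(bx i j); apply: (multilin_local hJ) => t.
by rewrite Jij !inE !updE => /orP[] /eqP ->; rewrite ?eqxx // eq_sym (negPf ji).
Qed.

End Forms.

Section Isotropic.
Variable p : nat.
Hypothesis p_pr : prime p.
Notation F := 'F_p.
Variables (n : nat) (S : finType).
Notation V := 'rV[F]_n.
Variables (l : S -> V -> F) (b : S -> V -> V -> F).
Hypotheses (lL : forall s, linear_form (l s)) (bL : forall s, bilinear_form (b s)).

(** Subspaces are given by a basis [M], so that the restriction of a function to them is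
    again a function on row vectors. *)
Definition isotropic m (M : 'M[F]_(m, n)) := [/\ row_free M,
  forall s y, l s (y *m M) = 0 & forall s y y', b s (y *m M) (y' *m M) = 0].

Lemma kernel_mx (K : finType) (phi : K -> V -> F) : (forall k, linear_form (phi k)) ->
  exists N : 'M[F]_(n, #|K|), forall v, v *m N = 0 -> forall k, phi k v = 0.
Proof.
move=> phiL; exists (\matrix_(i, k) phi (enum_val k) (delta_mx 0 i)) => v /rowP vN k.
have := vN (enum_rank k); rewrite !mxE => <-.
rewrite -{1}[v]mulmx1 linear_form_sum //; apply: eq_bigr => i _.
by rewrite mxE enum_rankK row1.
Qed.

(** In a complement of [M] inside the subspace orthogonal to [M] on both sides, a new
    vector [v] only has to satisfy the quadratic equations [b s v v = 0]. *)
Lemma isotropic_extend D m (M : 'M[F]_(m, n)) : (#|S| <= D)%N -> isotropic M ->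
  ((2 * D + 1) * m + (3 * D + 1) <= n)%N -> exists M' : 'M[F]_(1 + m, n), isotropic M'.
Proof.
move=> SD [Mfree Ml Mb] nbig.
pose phi (k : S + (S * 'I_m + S * 'I_m)) : V -> F := match k with
  | inl s => l s | inr (inl (s, i)) => b s ^~ (row i M) | inr (inr (s, i)) => b s (row i M)
  end.
have phiL k : linear_form (phi k).
  case: k => [s|[[s i]|[s i]]] /=; [exact: lL | exact: (bL s).1 | exact: (bL s).2].
have [N NP] := kernel_mx phiL.
pose U := (kermx N :\: M)%MS.
have Ubig : (2 * #|S| < \rank U)%N.
  have := mxrank_cap_compl (kermx N) M; rewrite -/U.
  have : (\rank (kermx N :&: M)%MS <= m)%N.
    by apply: leq_trans (mxrankS (capmxSr _ _)) (rank_leq_row M).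
  have : (\rank N <= #|S| + (#|S| * m + #|S| * m))%N.
    by apply: leq_trans (rank_leq_col N) _; rewrite !card_sum !card_prod card_ord.
  rewrite mxrank_ker; move: (\rank _) (\rank _) (\rank _) => rN rC rU.
  have := leq_mul SD (leqnn m); move: SD nbig; rewrite mulnDl mul1n -mulnA.
  by move: (D * m)%N (#|S| * m)%N => Dm Sm; clear; lia.
pose B := row_base U.
have Bker y : (y *m B) *m N = 0.
  apply/sub_kermxP; apply: submx_trans (submxMl _ _) _.
  by rewrite eq_row_base diffmxSl.
pose Q s (y : 'rV[F]_(\rank U)) := b s (y *m B) (y *m B).
have [||y y0 Qy] := common_root p_pr Ubig (Q := Q).
- move=> s.
  have bE : Q s = (fun y => \sum_i y 0 i * \sum_j y 0 j * b s (row i B) (row j B)).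
    apply/funext => y; rewrite /Q (linear_form_sum y B ((bL s).1 _)).
    by apply: eq_bigr => i _; rewrite (linear_form_sum y B ((bL s).2 _)).
  rewrite bE; apply: deg_lt_sum => i _; apply: (@deg_ltM _ _ 1 1).
    by apply: deg_lt_additive => u v; rewrite mxE.
  by apply: deg_lt_additive => u v; rewrite -big_split; apply: eq_bigr => j _; rewrite mxE mulrDl.
- by move=> s; rewrite /Q mul0mx (linear_form0 ((bL s).1 _)).
pose v := y *m B.
have vphi k : phi k v = 0 by apply: NP; apply: Bker.
have v0 : v != 0.
  apply: contra y0 => /eqP vB; apply/eqP; apply: (row_free_inj (row_base_free U)).
  by rewrite -/B -/v vB mul0mx.
have vM s z : b s v (z *m M) = 0.
  rewrite (linear_form_sum z M ((bL s).2 _)) big1 // => i _.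
  by rewrite (_ : b s v (row i M) = 0) ?mulr0 //; apply: (vphi (inr (inl (s, i)))).
have Mv s z : b s (z *m M) v = 0.
  rewrite (linear_form_sum z M ((bL s).1 _)) big1 // => i _.
  by rewrite (_ : b s (row i M) v = 0) ?mulr0 //; apply: (vphi (inr (inr (s, i)))).
have colE (z : 'rV_(1 + m)) :
    z *m col_mx v M = lsubmx z 0 0 *: v + rsubmx z *m M.
  by rewrite -{1}[z]hsubmxK mul_row_col {1}[lsubmx z]mx11_scalar mul_scalar_mx.
exists (col_mx v M); split=> [|s z|s z z'].
- rewrite /row_free -addsmxE mxrank_disjoint_sum ?(eqP Mfree) ?rank_rV ?v0 //.
  have vU : (v <= U)%MS by rewrite (submx_trans (submxMl _ _)) // eq_row_base.
  apply/eqP; rewrite -submx0; apply: submx_trans (capmxS vU (submx_refl M)) _.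
  by rewrite capmx_diff.
- by rewrite colE lL Ml addr0 (_ : l s v = 0) ?mulr0 //; apply: (vphi (inl s)).
have bvv : b s v v = 0 := Qy s.
rewrite !colE (bL s).1 !(bL s).2 vM Mv Mb bvv.
by rewrite !(mulr0, addr0).
Qed.

Lemma isotropic_exists D : (#|S| <= D)%N ->
  exists (m : nat) (M : 'M[F]_(m, n)), isotropic M /\ (n <= (3 * D + 1) * m.+1)%N.
Proof.
move=> SD.
have ex m : ((2 * D + 1) * m + D <= n)%N \/ m = 0%N -> exists M : 'M[F]_(m, n), isotropic M.
  elim: m => [_|m IH [nm|//]].
    exists 0; split=> [|s y|s y y']; first by rewrite /row_free mxrank0.
      by rewrite mulmx0 (linear_form0 (lL s)).
    by rewrite !mulmx0 (linear_form0 ((bL s).1 _)).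
  have [M Miso] : exists M : 'M[F]_(m, n), isotropic M.
    by apply: IH; left; apply: leq_trans nm; rewrite leq_add2r leq_mul2l leqnSn orbT.
  apply: (isotropic_extend SD Miso); move: nm; rewrite mulnS.
  by clear; lia.
pose m := ((n - D) %/ (2 * D + 1))%N.
have [|M Miso] := ex m.
  have [nD|nD] := leqP D n; [left | right].
    by have := leq_trunc_div (n - D) (2 * D + 1); rewrite -/m mulnC; lia.
  by rewrite /m (eqP (_ : (n - D == 0)%N)) ?div0n // subn_eq0 ltnW.
exists m, M; split=> //.
have d0 : (0 < 2 * D + 1)%N by rewrite addn1.
have := ltn_ceil (n - D) d0; rewrite -/m; move: (m.+1) (ltn0Sn m) => k k0 lt.
have := leq_pmulr D k0; move: lt; clear; nia.
Qed.

End Isotropic.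

(** * From a biased function to its top derivative *)

Section Gowers.
Variables (F : finFieldType) (n : nat) (C : numClosedFieldType) (psi : F -> C).
Hypothesis psiP : addchar psi.
Notation V := 'rV[F]_n.
Implicit Types (f g : V -> F).

Definition biased_fun r f := (#|{: V}|%:R <= `|\sum_x psi (f x)| * #|F|%:R ^+ r).

Lemma norm_sum_sq f :
  `|\sum_y psi (f y)| ^+ 2 = \sum_h \sum_y psi (delta h f y).
Proof.
rewrite normCK rmorph_sum /= big_distrlr exchange_big /=.
rewrite exchange_big /= [RHS]exchange_big /=.
rewrite [LHS]exchange_big /=; apply: eq_bigr => y _.
rewrite [LHS](reindex_inj (addrI y)) /=; apply: eq_bigr => h _.
by rewrite -(psiN psiP) -(psiD psiP).
Qed.

Lemma cauchy_schwarz (T : finType) (a : T -> C) : (forall t, 0 <= a t) ->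
  (\sum_t a t) ^+ 2 <= #|T|%:R * \sum_t a t ^+ 2.
Proof.
move=> a0.
have : 0 <= \sum_t \sum_u (a t - a u) ^+ 2.
  apply: sumr_ge0 => t _; apply: sumr_ge0 => u _.
  by rewrite real_exprn_even_ge0 // rpredB // ger0_real.
have -> : \sum_t \sum_u (a t - a u) ^+ 2 =
    2 * (#|T|%:R * \sum_t a t ^+ 2) - 2 * (\sum_t a t) ^+ 2.
  under eq_bigr do under eq_bigr do rewrite sqrrB.
  transitivity (\sum_t \sum_u (a t ^+ 2 + a u ^+ 2 - 2 * (a t * a u))).
    by apply: eq_bigr => t _; apply: eq_bigr => u _; ring.
  under eq_bigr do rewrite sumrB big_split /= sumr_const -big_distrr /= -big_distrr /=.
  rewrite sumrB big_split /= sumr_const -!big_distrr /= -big_distrl /= sumrMnl.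
  by rewrite -[_ *+ _]mulr_natl; ring.
by rewrite subr_ge0 ler_pM2l // ltr0n.
Qed.

Variable d : nat.
Notation X := {ffun 'I_d -> V}.

(** The directions of the derivatives are read off a point [x], so that averaging over
    them is averaging over [x]. *)
Definition cube_avg f (s : seq 'I_d) (x : X) : C :=
  `|\sum_y psi (der [seq x i | i <- s] f y)| / #|{: V}|%:R.

Lemma cube_avg_sq f s i : i \notin s ->
  \sum_x cube_avg f s x ^+ 2 =
  \sum_(x : X) (\sum_y psi (der [seq x j | j <- rcons s i] f y)) / #|{: V}|%:R.
Proof.
move=> si.
have V0 : (#|{: V}|%:R : C) != 0.
  by rewrite pnatr_eq0 -lt0n; apply/card_gt0P; exists 0.
pose B (x : X) := (\sum_y psi (der [seq x j | j <- rcons s i] f y)) / #|{: V}|%:R.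
have E x : cube_avg f s x ^+ 2 = (\sum_u B (upd x i u)) / #|{: V}|%:R.
  rewrite /cube_avg expr_div_n norm_sum_sq /B -big_distrl /= expr2 invfM mulrA.
  congr (_ / _ / _); apply: eq_bigr => u _; apply: eq_bigr => y _.
  rewrite map_rcons der_rcons updE eqxx; congr (psi (delta u (der _ f) y)).
  apply/eq_in_map => j js; rewrite updE; case: eqP => // ji.
  by rewrite -ji js in si.
under eq_bigr do rewrite E.
by rewrite -big_distrl /= sum_upd -[(\sum_x _) *+ _]mulr_natr mulfK.
Qed.

Lemma gowers_step f r s i : i \notin s ->
  #|{: X}|%:R <= (\sum_x cube_avg f s x) * #|F|%:R ^+ r ->
  #|{: X}|%:R <= (\sum_(x : X) (\sum_y psi (der [seq x j | j <- rcons s i] f y)) / #|{: V}|%:R)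
     * #|F|%:R ^+ (2 * r).
Proof.
move=> si le; rewrite -(cube_avg_sq f si).
have X0 : (0 : C) < #|{: X}|%:R by rewrite ltr0n; apply/card_gt0P; exists [ffun=> 0].
have a0 x : 0 <= cube_avg f s x by rewrite divr_ge0.
rewrite -(ler_pM2l X0) mulrA.
apply: le_trans (ler_wpM2r _ (cauchy_schwarz a0)); last by rewrite exprn_ge0.
rewrite mulnC exprM -exprMn -expr2.
by rewrite ler_pXn2r // ?nnegrE ?ler0n // mulr_ge0 ?exprn_ge0 // sumr_ge0.
Qed.

(** Each new direction costs one application of Cauchy-Schwarz, which doubles the
    exponent. *)
Lemma gowers f r (s : seq 'I_d) : uniq s -> biased_fun r f ->
  #|{: X}|%:R <= (\sum_x cube_avg f s x) * #|F|%:R ^+ (2 ^ size s * r).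
Proof.
move=> + fb; elim/last_ind: s => [_|s i IH].
  have V0 : (0 : C) < #|{: V}|%:R.
    by rewrite ltr0n; apply/card_gt0P; exists 0.
  rewrite (eq_bigr (fun=> `|\sum_y psi (f y)| / #|{: V}|%:R)) // sumr_const mul1n.
  rewrite -[X in _ <= X * _]mulr_natl -mulrA ler_peMr // mulrAC ler_pdivlMr // mul1r.
  exact: fb.
rewrite rcons_uniq => /andP[si us]; apply: le_trans (gowers_step si (IH us)) _.
rewrite size_rcons expnS mulnA; apply: ler_wpM2r; first by rewrite exprn_ge0.
have sq0 : 0 <= \sum_x cube_avg f s x ^+ 2.
  by apply: sumr_ge0 => x _; rewrite exprn_ge0 // divr_ge0.
rewrite -(cube_avg_sq f si) -(ger0_norm sq0) (cube_avg_sq f si).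
apply: le_trans (ler_norm_sum _ _ _) _; apply: ler_sum => x _.
by rewrite normf_div normr_nat.
Qed.

End Gowers.

Section TopForm.
Variable p : nat.
Notation F := 'F_p.

Lemma deg_lt_der (V : zmodType) (K : comPzRingType) (s : seq V) e (f : V -> K) :
  deg_lt (size s + e) f -> deg_lt e (der s f).
Proof. by elim: s f => //= h s IH f fd; apply: IH; apply: fd. Qed.

Lemma der_deg_lt1 (V : zmodType) (K : comPzRingType) (g : V -> K) x y :
  deg_lt 1 g -> g x = g y.
Proof.
move=> gd; have /funeqP/(_ y) := gd (x - y); rewrite /delta [y + _]addrC subrK.
by move/eqP; rewrite subr_eq0 => /eqP.
Qed.

Variables (n d : nat).
Notation V := 'rV[F]_n.
Notation X := {ffun 'I_d -> V}.

Definition top_form (f : V -> F) (x : X) : F := der [seq x i | i <- enum 'I_d] f 0.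

(** The second derivative in the directions [u] and [v] of the remaining iterated
    derivative vanishes, which is additivity in the slot considered; over a prime
    field, additive maps are linear. *)
Lemma multilin_top_form f : deg_lt d.+1 f -> multilin [set: 'I_d] (top_form f).
Proof.
move=> fd; split=> i; rewrite ?inE // => _ x.
have [s1 [s2 [es i1 i2]]] : exists s1 s2, [/\ enum 'I_d = s1 ++ i :: s2, i \notin s1 & i \notin s2].
  have := enum_uniq 'I_d; have : i \in enum 'I_d by rewrite mem_enum.
  case/splitPr => s1 s2; rewrite uniq_catC /= => /andP[].
  by rewrite mem_cat negb_or => /andP[? ?] _; exists s1, s2.
pose t := [seq x j | j <- s1 ++ s2]; pose g := der t f.
have gE u : top_form f (upd x i u) = delta u g 0.
  rewrite /top_form es map_cat /= der_cat /= updE eqxx.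
  have upd_map s : i \notin s -> [seq upd x i u j | j <- s] = [seq x j | j <- s].
    move=> is_; apply/eq_in_map => j js; rewrite updE; case: eqP => // ji.
    by rewrite -ji js in is_.
  by rewrite !upd_map // -delta_der /g /t map_cat der_cat.
have gd : deg_lt 2 g.
  apply: deg_lt_der; rewrite /t size_map (_ : (_ + 2 = d.+1)%N) // addn2; congr S.
  by rewrite -[RHS](size_enum_ord d) es !size_cat /= addnS.
have gD : {morph (fun u => delta u g 0) : u v / u + v}.
  move=> u v; have /funeqP/(_ 0) := gd u v; rewrite /delta !add0r => e.
  by apply/eqP; rewrite -subr_eq0 -[X in _ == X]e [v + u]addrC; apply/eqP; ring.
move=> a u v; rewrite !gE gD; congr (_ + _).
exact: (Fp_scale_additive a u gD).
Qed.

End TopForm.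

Section TopBias.
Variables (p : nat) (C : numClosedFieldType) (psi : 'F_p -> C).
Hypothesis psiP : addchar psi.

Lemma der_base n d (f : 'rV['F_p]_n -> 'F_p) (x : {ffun 'I_d -> 'rV['F_p]_n}) y :
  deg_lt d.+1 f -> der [seq x i | i <- enum 'I_d] f y = top_form f x.
Proof.
by move=> fd; apply: der_deg_lt1; apply: deg_lt_der; rewrite size_map size_enum_ord addn1.
Qed.

Lemma biased_top_form n d r (f : 'rV['F_p]_n -> 'F_p) : deg_lt d.+2 f ->
  biased_fun psi r f -> biased psi (2 ^ d.+1 * r) (top_form (d := d.+1) f).
Proof.
move=> fd fb.
have [s [i es]] : exists s i, enum 'I_d.+1 = rcons s i.
  by have := size_enum_ord d.+1; case/lastP: (enum _) => // s i _; exists s, i.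
have := enum_uniq 'I_d.+1; have := size_enum_ord d.+1; rewrite es.
rewrite size_rcons rcons_uniq => -[sz] /andP[si us].
have := gowers_step psiP si (gowers psiP us fb).
rewrite sz mulnA -expnS /biased.
have V0 : (#|{: 'rV['F_p]_n}|%:R : C) != 0.
  by rewrite pnatr_eq0 -lt0n; apply/card_gt0P; exists 0.
have -> : \sum_(x : {ffun 'I_d.+1 -> 'rV['F_p]_n})
     (\sum_y psi (der [seq x j | j <- rcons s i] f y)) /
     #|{: 'rV['F_p]_n}|%:R = \sum_(x : {ffun 'I_d.+1 -> 'rV['F_p]_n}) psi (top_form f x).
  apply: eq_bigr => x _; rewrite (eq_bigr (fun=> psi (top_form f x))) => [|y _].
    by rewrite sumr_const -[_ *+ _]mulr_natr mulfK.
  by rewrite -es der_base.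
have iT : i \in [set: 'I_d.+1] by rewrite inE.
rewrite (sum_psi_lin_card psiP ((multilin_top_form fd).1 i iT)).
by rewrite normr_nat.
Qed.

End TopBias.

(** * Lowering the degree on a subspace *)

Section Restrict.
Variables (F : finFieldType) (C : numClosedFieldType) (psi : F -> C).
Variables (n m : nat) (M : 'M[F]_(m, n)).
Implicit Types (f : 'rV[F]_n -> F) (a : 'rV[F]_n).

Definition restrict f a (y : 'rV[F]_m) := f (a + y *m M).

Lemma der_restrict f a s :
  der s (restrict f a) = restrict (der [seq h *m M | h <- s] f) a.
Proof.
elim/last_ind: s => [|s h IH]; first by apply/funext.
rewrite der_rcons IH map_rcons der_rcons; apply/funext => y.
by rewrite /delta /restrict mulmxDl addrA.
Qed.

(** The exponential sum of [f] is the average of those of its restrictions to the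
    cosets. *)
Lemma restrict_biased f r : biased_fun psi r f ->
  exists a, biased_fun psi r (restrict f a).
Proof.
move=> fb; apply: contrapT => /forallNP no.
have F0 : (0 : C) <= #|F|%:R ^+ r by rewrite exprn_ge0.
have lt a : `|\sum_y psi (restrict f a y)| * #|F|%:R ^+ r < #|{: 'rV[F]_m}|%:R.
  by rewrite real_ltNge ?realn ?ger0_real ?mulr_ge0 //; apply/negP/no.
have E : \sum_a \sum_y psi (restrict f a y) =
    #|{: 'rV[F]_m}|%:R * \sum_x psi (f x).
  rewrite exchange_big mulr_natl -sumr_const; apply: eq_bigr => y _.
  by rewrite [RHS](reindex_inj (addIr (y *m M))).
have m0 : (0 : C) < #|{: 'rV[F]_m}|%:R by rewrite ltr0n; apply/card_gt0P; exists 0.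
have : #|{: 'rV[F]_m}|%:R * #|{: 'rV[F]_n}|%:R < #|{: 'rV[F]_m}|%:R * #|{: 'rV[F]_n}|%:R :> C.
  apply: le_lt_trans (_ : \sum_a (`|\sum_y psi (restrict f a y)| * #|F|%:R ^+ r) < _).
    rewrite -big_distrl /=; apply: le_trans (ler_wpM2r F0 (ler_norm_sum _ _ _)).
    by rewrite E normrM normr_nat -mulrA ler_pM2l.
  have -> : #|{: 'rV[F]_m}|%:R * #|{: 'rV[F]_n}|%:R =
      \sum_(a : 'rV[F]_n) #|{: 'rV[F]_m}|%:R :> C by rewrite sumr_const mulr_natr.
  apply: ltr_sum => [|a _]; last exact: lt.
  by apply/hasP; exists 0 => //; apply: mem_index_enum.
by rewrite ltxx.
Qed.

End Restrict.

(** Two complementary parts of at most 5 slots cannot both have more than 2 slots. *)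
Lemma reduce_degree d r : (d <= 4)%N -> exists c, forall p, prime p ->
  forall (C : numClosedFieldType) (psi : 'F_p -> C) n (f : 'rV['F_p]_n -> 'F_p),
  addchar psi -> deg_lt d.+2 f -> biased_fun psi r f ->
  exists m (M : 'M['F_p]_(m, n)) a, [/\ row_free M, (n <= c * m.+1)%N,
    deg_lt d.+1 (restrict M f a) & biased_fun psi r (restrict M f a)].
Proof.
move=> d4; have [D DP] := uniform_rank_bound_exists 'I_d.+1 d.+1 (2 ^ d.+1 * r).
exists (3 * D + 1)%N => p p_pr C psi n f psiP fd fb.
have Tl := multilin_top_form fd.
have sz0 : (0 < #|[set: 'I_d.+1]| <= d.+1)%N by rewrite cardsT card_ord leqnn.
have [S [dS [g [h [SD dSP ghP TE]]]]] :=
  DP _ _ _ n psiP _ _ sz0 Tl (biased_top_form psiP fd fb).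
have lowfac s : exists lb : ('rV['F_p]_n -> 'F_p) * ('rV['F_p]_n -> 'rV['F_p]_n -> 'F_p),
    [/\ linear_form lb.1, bilinear_form lb.2 & forall x : {ffun 'I_d.+1 -> 'rV['F_p]_n},
      (forall i, lb.1 (x i) = 0) -> (forall i j, lb.2 (x i) (x j) = 0) -> g s x * h s x = 0].
  have [d0 dT] := dSP s; have [gl hl] := ghP s.
  have cT := cardsID (dS s) [set: 'I_d.+1].
  rewrite setTI cardsT card_ord in cT.
  have := proper_card dT; rewrite cardsT card_ord => dlt.
  have [d2|d2] := leqP #|dS s| 2.
    have [|l [b [lL bL lb]]] := low_order_form gl; first by rewrite card_gt0 d0.
    by exists (l, b); split=> // x x1 x2; rewrite (lb x x1 x2) mul0r.
  have [|l [b [lL bL lb]]] := low_order_form hl; first by lia.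
  by exists (l, b); split=> // x x1 x2; rewrite (lb x x1 x2) mulr0.
have [lb lbP] := choice lowfac.
have lL s : linear_form (lb s).1 by have [] := lbP s.
have bL s : bilinear_form (lb s).2 by have [] := lbP s.
have [m [M [[Mfree Ml Mb] nm]]] := isotropic_exists p_pr lL bL SD.
have [a fa] := restrict_biased M fb.
exists m, M, a; split=> //; apply/deg_ltP => s sz.
rewrite der_restrict; apply/funext => y; rewrite /restrict.
pose x : {ffun 'I_d.+1 -> 'rV['F_p]_n} := [ffun i : 'I_d.+1 => nth 0 s i *m M].
have -> : [seq v *m M | v <- s] = [seq x i | i <- enum 'I_d.+1].
  rewrite -{1}[s](mkseq_nth 0) /mkseq sz -val_enum_ord -!map_comp.
  by apply: eq_map => i /=; rewrite ffunE.
rewrite der_base // TE big1 // => t _; have [_ _] := lbP t; apply=> i.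
  by rewrite ffunE Ml.
by move=> j; rewrite !ffunE Mb.
Qed.

Lemma constant_subspace d r : (d <= 5)%N -> exists c, forall p, prime p ->
  forall (C : numClosedFieldType) (psi : 'F_p -> C) n (f : 'rV['F_p]_n -> 'F_p),
  addchar psi -> deg_lt d.+1 f -> biased_fun psi r f ->
  exists m (M : 'M['F_p]_(m, n)) a, [/\ row_free M, (n <= c * m.+1)%N &
    forall y, f (a + y *m M) = f a].
Proof.
elim: d => [_|d IH d5].
  exists 1%N => p p_pr C psi n f psiP fd fb.
  exists n, 1%:M, 0; split=> [||y].
  - by rewrite row_free_unit unitmx1.
  - by rewrite mul1n.
  exact: der_deg_lt1.
have [c0 red] := @reduce_degree d r d5; have [c1 {}IH] := IH (ltnW d5).
exists (c0 * (c1 + 1))%N => p p_pr C psi n f psiP fd fb.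
have [m [M [a [Mfree nm gd gb]]]] := red p p_pr C psi n f psiP fd fb.
have [m' [M' [a' [Mfree' mm' gc]]]] := IH p p_pr C psi m _ psiP gd gb.
exists m', (M' *m M), (a + a' *m M); split=> [||y].
- by rewrite /row_free mxrankMfree.
- apply: leq_trans nm _; rewrite -mulnA leq_mul2l; apply/orP; right.
  by rewrite mulnDl mul1n -addn1 leq_add.
by have := gc y; rewrite /restrict mulmxDl mulmxA addrA.
Qed.

(** * The main theorem *)

Lemma function_degree_deg_lt p n d (f : 'rV['F_p]_n -> 'F_p) :
  function_degree f d -> deg_lt d.+1 f.
Proof.
case=> P [_ Pf Pd].
have -> : f = (fun x => \sum_(m <- msupp P) P@_m * \prod_(i < n) x 0 i ^+ m i).
  by apply/funext => x; rewrite Pf mevalE.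
apply: deg_lt_sum => m mP; have := msize_mdeg_lt mP; rewrite Pd => md.
apply: (deg_lt_leq md); apply: (@deg_ltM _ _ 0 (mdeg m)); first exact: deg_lt_const.
rewrite mdegE; apply: (@deg_lt_prod _ _ _ _ (fun i => m i)) => i.
have := @deg_ltX _ _ (m i) 1 (fun x : 'rV['F_p]_n => x 0 i); rewrite mul1n; apply.
by apply: deg_lt_additive => x y; rewrite mxE.
Qed.

Section RootOfUnity.
Local Open Scope complex_scope.
Variables (R : realType) (p : nat).
Hypothesis p_pr : prime p.

Lemma omegaX k : omega R p ^+ k =
  cos (2%:R * pi / p%:R * k%:R) +i* sin (2%:R * pi / p%:R * k%:R).
Proof.
rewrite /omega; set t := _ / _; elim: k => [|k IH].
  by rewrite expr0 mulr0 cos0 sin0.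
by rewrite exprS IH mulrS mulrDr mulr1 cosD sinD; simpc; congr (_ +i* _); ring.
Qed.

Lemma omega_p : omega R p ^+ p = 1.
Proof.
have p0 : p%:R != 0 :> R by rewrite pnatr_eq0 -lt0n prime_gt0.
by rewrite omegaX mulfVK // mulr_natl cos2pi sin2pi.
Qed.

Lemma omega_neq1 : omega R p != 1.
Proof.
have p0 : 0 < p%:R :> R by rewrite ltr0n prime_gt0.
have t0 : 0 < 2%:R * pi / p%:R :> R by rewrite divr_gt0 // mulr_gt0 // pi_gt0.
rewrite eq_complex /= negb_and; apply/orP; left; apply/eqP => c1.
have c : 2%:R * pi / p%:R = 0 :> R.
  apply: cos_inj; rewrite ?cos0 // !in_itv /= ?lexx ?pi_ge0 // ltW //=.
  by rewrite ler_pdivrMr // [X in _ <= X]mulrC ler_pM2r ?pi_gt0 // ler_nat prime_gt1.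
by rewrite c ltxx in t0.
Qed.

Definition fp_char (a : 'F_p) : R[i] := omega R p ^+ a.

Lemma addchar_fp_char : addchar fp_char.
Proof.
split.
- move=> a b; rewrite /fp_char -exprD -[RHS](expr_mod _ omega_p).
  by congr (_ ^+ _); apply: (congr1 (modn _) (Fp_cast p_pr)).
- move=> a; rewrite /fp_char normrX.
  rewrite (_ : `|omega R p| = 1) ?expr1n //.
  by rewrite /omega normc_def /= cos2Dsin2 sqrtr1.
exists 1; rewrite /fp_char.
have -> : (1 : 'F_p) = 1%N :> nat by [].
exact: omega_neq1.
Qed.

End RootOfUnity.

Lemma rowspace_vspace (F : fieldType) m n (M : 'M[F]_(m, n)) : row_free M ->
  exists W : {vspace 'rV[F]_n}, \dim W = m /\
    forall x, x \in W -> exists y, x = y *m M.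
Proof.
move=> Mfree; pose phi := linfun (mulmxr M : 'rV[F]_m -> 'rV[F]_n).
exists (limg phi); split=> [|x /memv_imgP[y _ ->]]; last by exists y; rewrite lfunE.
rewrite limg_dim_eq ?dimvf ?dim_matrix ?mul1r ?mul1n //.
apply/eqP; rewrite -subv0 capfv; apply/subvP => y.
rewrite memv_ker lfunE /= memv0 => /eqP yM; apply/eqP.
by apply: (row_free_inj Mfree); rewrite yM mul0mx.
Qed.

(** Since [#|F| >= 2], a lower bound [2 ^- r] for the bias yields an exponent [r] which
    is independent of the field. *)
Lemma biased_fun_of_bias (R : realType) p n (f : 'rV['F_p]_n -> 'F_p) (delta : R) r :
  prime p -> 1 <= delta * 2 ^+ r -> bias R f = delta -> biased_fun (fp_char R (p := p)) r f.
Proof.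
move=> p_pr dr bf; rewrite /biased_fun.
set N := #|_|; have N0 : (0 < N)%N by apply/card_gt0P; exists 0.
have NC : (0 : R[i]) < N%:R by rewrite ltr0n.
have nE z : `|z| = (ComplexField.Normc.normc z)%:C%C by [].
have -> : `|\sum_x fp_char R (f x)| = delta%:C%C * N%:R.
  by rewrite -bf /bias -nE normf_div normr_nat divfK ?gt_eqF.
rewrite card_Fp // mulrAC -[X in X <= _]mul1r ler_pM2r //.
have d0 : 0 <= delta by rewrite -bf /bias -ler0c -nE.
apply: le_trans (_ : delta%:C%C * 2 ^+ r <= _); last first.
  apply: ler_wpM2l; first by rewrite ler0c.
  by rewrite lerXn2r ?nnegrE ?ler0n // ler_nat prime_gt1.
have -> : delta%:C%C * 2 ^+ r = (delta * 2 ^+ r)%:C%C.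
  by rewrite (rmorphM (real_complex R)) (rmorphXn (real_complex R)) (rmorph_nat (real_complex R)).
by rewrite -[1]/(1%:C%C) lecR.
Qed.

Theorem theorem1p5 (R : realType) (delta : R) (hdelta : 0 < delta) :
  exists (kappa : R) (n0 : nat), 0 < kappa /\
    forall (p : nat), prime p ->
    forall (n : nat), (n0 <= n)%N ->
    forall f : 'rV['F_p]_n -> 'F_p,
      function_degree f 5 -> bias R f = delta ->
      exists (a : 'rV['F_p]_n) (W : {vspace 'rV['F_p]_n}),
        kappa * n%:R <= (\dim W)%:R /\ constant_on f (affine_subspace a W).
Proof.
have [r dr] : exists r, 1 <= delta * 2 ^+ r.
  exists (Num.bound delta^-1); rewrite -ler_pdivrMl // mulr1.
  have := archi_boundP (ltW (_ : 0 < delta^-1)); rewrite invr_gt0 => /(_ hdelta)/ltW/le_trans; apply.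
  by rewrite -natrX ler_nat ltnW // ltn_expl.
have [c cP] := @constant_subspace 5 r isT.
exists (2 * c.+1)%:R^-1, (2 * c.+1)%N; split; first by rewrite invr_gt0 ltr0n.
move=> p p_pr n nbig f f5 bf.
have [m [M [a [Mfree nm fM]]]] := cP p p_pr _ _ n f (addchar_fp_char R p_pr)
  (function_degree_deg_lt f5) (biased_fun_of_bias p_pr dr bf).
have [W [dW WM]] := rowspace_vspace Mfree.
exists a, W; split.
  rewrite dW mulrC ler_pdivrMr ?ltr0n // -natrM ler_nat.
  by move: nm nbig; clear; nia.
exists (f a) => x; rewrite inE => /WM[y xy].
by rewrite -(fM y) -xy addrC subrK.
Qed.
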